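(* Let $M_0$ be the square-tiled surface made of four unit squares labelled $1,2,3,4$ in which the right side of square $i$ is glued to the left side of square $h(i)$ and the top side of square $i$ is glued to the bottom side of square $v(i)$, where $h=(2\,3\,4)$ and $v=(1\,2)(3\,4)$. Then $M_0$ has no convex presentation. Moreover, any square-tiled surface in $\mathcal{H}(1,1)$ made of seven squares or fewer has no strictly convex presentation.
   Context: A translation surface is a connected closed surface obtained from polygons in $\mathbb{R}^2$ by gluing edges in pairs by translations, up to cut-and-paste equivalence. $\mathcal{H}(1,1)$ is the stratum of genus two translation surfaces with two distinct singularities, each of cone angle $4\pi$. A square-tiled surface is a translation surface obtained from finitely many unit squares (with horizontal and vertical sides) by gluing right sides to left sides and top sides to bottom sides by translations. A translation surface $M$ has a (strictly) convex presentation if $M$ is obtained from a single (strictly) convex polygon $P\subset\mathbb{R}^2$ by identifying its edges in pairs by translations. A polygon is strictly convex if all internal angles at its vertices are strictly less than $\pi$. A convex polygon may have vertices with internal angle $\pi$, but polygons have no spurious vertices: no edge is strictly contained in a larger straight boundary segment on which the edge identification map extends continuously. *)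

(* Defs.v *)
From Stdlib Require Import Relation_Operators.
From HB Require Import structures.
From mathcomp Require Import all_boot all_order all_algebra all_fingroup.
From mathcomp Require Import reals trigo.

Set Implicit Arguments.
Unset Strict Implicit.
Unset Printing Implicit Defensive.

Import Order.TTheory GRing.Theory Num.Theory.
Local Open Scope ring_scope.

Section Plane.
Variable R : realType.
Implicit Types u v : R * R.

Definition dot u v : R := u.1 * v.1 + u.2 * v.2.
Definition cross u v : R := u.1 * v.2 - u.2 * v.1.
Definition scale (t : R) u : R * R := (t * u.1, t * u.2).
Definition norm2 u : R := Num.sqrt (dot u u).
Definition angle u v : R := acos (dot u v / (norm2 u * norm2 v)).

End Plane.

(* A finite collection of disjoint polygons with an edge pairing.  Every edge
   belongs to exactly one polygon ([face_of]) and is oriented so that the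
   boundary of its polygon is traversed counterclockwise: it runs from
   [start e] to [start (nxt e)], and [nxt e] is the edge that follows it.
   Each polygon has its own copy of the plane, so distinct polygons may have
   overlapping coordinates. *)
Record gluing (R : realType) := Gluing {
  face : finType;
  edge : finType;
  face_of : edge -> face;
  nxt : edge -> edge;
  start : edge -> R * R;
  glue : edge -> edge
}.

Section TranslationSurfaces.
Variable R : realType.
Implicit Types S U P : gluing R.

Definition edge_vec S (e : edge S) : R * R := start (nxt e) - start e.

(* The closed polygonal region of a face; correct for the convex polygons
   described by [convex_polygons]. *)
Definition region S (A : face S) (x : R * R) : Prop :=
  forall e : edge S, face_of e = A -> 0 <= cross (edge_vec e) (x - start e).

(* The edges of each face form one cycle of [nxt], and the vertices met along
   it are distinct, not collinear, and never strictly to the right of an edge.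
   Such a cycle goes once counterclockwise around a convex polygon with
   nonempty interior; interior angles equal to pi are allowed. *)
Definition convex_polygons S : Prop :=
  [/\ injective (@nxt R S),
      forall e f : edge S, fconnect (@nxt R S) e f = (face_of e == face_of f),
      forall A : face S, exists e : edge S, face_of e = A,
      forall e f : edge S, face_of e = face_of f -> start e = start f -> e = f
    & forall A : face S,
        (forall e : edge S, face_of e = A -> region A (start e)) /\
        (exists e f : edge S, [/\ face_of e = A, face_of f = A
           & 0 < cross (edge_vec e) (start f - start e)])].

(* With both boundaries counterclockwise, two edges are exchanged by a
   translation that puts their polygons on opposite sides exactly when their
   vectors are opposite. *)
Definition translation_gluing S : Prop :=
  involutive (@glue R S) /\
  forall e : edge S, edge_vec (glue e) = - edge_vec e.

Definition connected_gluing S : Prop :=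
  forall e f : edge S,
    connect [rel x y : edge S | (y == nxt x) || (y == glue x)] e f.

(* Only convex polygons are used: any polygon can be cut into triangles, so
   this describes every translation surface up to cut-and-paste. *)
Definition translation_surface S : Prop :=
  [/\ convex_polygons S, translation_gluing S & connected_gluing S].

(* A point of the disjoint union of the polygons is a pair (face, position).
   [glued] relates a point of the edge e to the corresponding point of
   [glue e]; the start of e is matched with the end of [glue e]. *)
Definition glued S (p q : face S * (R * R)) : Prop :=
  exists (e : edge S) (t : R),
    [/\ 0 <= t <= 1,
        p = (face_of e, start e + scale t (edge_vec e))
      & q = (face_of (glue e),
             start (nxt (glue e)) + scale t (edge_vec e))].

Definition same_point S : face S * (R * R) -> face S * (R * R) -> Prop :=
  clos_refl_sym_trans _ (@glued S).

(* U is obtained from S by cutting its polygons into finitely many pieces (the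
   polygons of U): the polygon A of U, translated by [tr A], is a part of the
   polygon [phi A] of S, and two points of U are identified in U exactly when
   the corresponding points of S are, so that the sides of each cut are glued
   back to each other and the gluings of S are kept. *)
Definition cutting U S : Prop :=
  exists (phi : face U -> face S) (tr : face U -> R * R),
    [/\ forall A x, region A x -> region (phi A) (x + tr A),
        forall (B : face S) y, region B y ->
          exists A x, [/\ region A x, phi A = B & x + tr A = y]
      & forall A x A' x', region A x -> region A' x' ->
          (same_point (A, x) (A', x') <->
           same_point (phi A, x + tr A) (phi A', x' + tr A'))].

(* Cut S into the pieces U, then translate and reassemble the pieces to S'. *)
Definition cut_and_paste S S' : Prop :=
  exists U, [/\ translation_surface U, cutting U S & cutting U S'].

(* The corner of index e is the one at the end of the edge e. *)
Definition corner_angle S (e : edge S) : R :=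
  angle (- edge_vec e) (edge_vec (nxt e)).

(* The end of e is the start of [nxt e], which is identified with the end of
   [glue (nxt e)]; the orbits of [around] are thus the vertices of the
   surface. *)
Definition around S (e : edge S) : edge S := glue (nxt e).

Definition cone_angle S (e : edge S) : R :=
  \sum_(f | fconnect (@around S) e f) corner_angle f.

(* Euler's formula V - E + F = 2 - 2g, where [edge S] counts each of the E
   edges of the surface twice. *)
Definition has_genus S (g : nat) : Prop :=
  ((fcard (@around S) (edge S) + #|face S| + 2 * g)%N = (#|edge S|./2 + 2)%N).

Definition in_H11 S : Prop :=
  [/\ translation_surface S, has_genus S 2
    & exists e1 e2 : edge S,
        [/\ ~~ fconnect (@around S) e1 e2,
            cone_angle e1 = 4 * pi, cone_angle e2 = 4 * pi
          & forall e : edge S, ~~ fconnect (@around S) e1 e ->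
              ~~ fconnect (@around S) e2 e -> cone_angle e = 2 * pi]].

(* The edges e and [nxt e] lie in one straight boundary segment, and the
   identifications on e and on [nxt e] send their common vertex to the same
   vertex of the same polygon: the start of [glue e] and the end of
   [glue (nxt e)]. *)
Definition spurious S (e : edge S) : Prop :=
  corner_angle e = pi /\ nxt (glue (nxt e)) = glue e.

(* P is a single convex polygon (convexity is part of [translation_surface])
   without spurious vertices. *)
Definition one_polygon P : Prop :=
  [/\ translation_surface P, #|face P| = 1%N
    & forall e : edge P, ~ spurious e].

Definition has_convex_presentation S : Prop :=
  exists P, one_polygon P /\ cut_and_paste P S.

Definition has_strictly_convex_presentation S : Prop :=
  exists P, [/\ one_polygon P, forall e : edge P, corner_angle e < pi
    & cut_and_paste P S].

End TranslationSurfaces.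

Section SquareTiled.
Variable R : realType.
Variable n : nat.
Variables h v : {perm 'I_n}.

(* The sides of a unit square, numbered counterclockwise: 0 is the bottom,
   1 the right, 2 the top and 3 the left side. *)
Definition square_corner (k : 'I_4) : R * R :=
  match val k with
  | 0%N => (0, 0)
  | 1%N => (1, 0)
  | 2%N => (1, 1)
  | _ => (0, 1)
  end.

Definition neighbour (i : 'I_n) (k : 'I_4) : 'I_n :=
  match val k with
  | 0%N => (v^-1)%g i
  | 1%N => h i
  | 2%N => v i
  | _ => (h^-1)%g i
  end.

Definition square_tiled : gluing R :=
  @Gluing R 'I_n ('I_n * 'I_4)%type
    (fun e => e.1)
    (fun e => (e.1, ordS e.2))
    (fun e => square_corner e.2)
    (fun e => (neighbour e.1 e.2, ordS (ordS e.2))).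

End SquareTiled.

(* The square with label k is the ordinal k - 1. *)
Definition square_label (k : nat) : 'I_4 := inord k.-1.

(* In MathComp (s * t) x = t (s x). *)
Definition h0 : {perm 'I_4} :=
  (tperm (square_label 2) (square_label 3) *
   tperm (square_label 2) (square_label 4))%g.

Definition v0 : {perm 'I_4} :=
  (tperm (square_label 1) (square_label 2) *
   tperm (square_label 3) (square_label 4))%g.

Lemma h0E :
  [/\ h0 (square_label 1) = square_label 1,
      h0 (square_label 2) = square_label 3,
      h0 (square_label 3) = square_label 4
    & h0 (square_label 4) = square_label 2].
Proof.
by split; apply/val_inj; rewrite permM !permE /= -!val_eqE /= ?inordK //=
  -?val_eqE /= ?inordK.
Qed.

Lemma v0E :
  [/\ v0 (square_label 1) = square_label 2,
      v0 (square_label 2) = square_label 1,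
      v0 (square_label 3) = square_label 4
    & v0 (square_label 4) = square_label 3].
Proof.
by split; apply/val_inj; rewrite permM !permE /= -!val_eqE /= ?inordK //=
  -?val_eqE /= ?inordK.
Qed.

Definition M0 (R : realType) : gluing R := square_tiled R h0 v0.

(* Main.v *)
(* Let P be a one-polygon presentation of the square-tiled surface S.  The map
   S -> R^2 / Z^2 makes P -> R^2 / Z^2 a translation, so that one can speak of the
   lattice points of P, and a generic coset of Z^2 has one point in P for each square
   of S.

   For M0 every corner of a square is singular, so no lattice point is interior to P.
   Of five lattice points two are congruent modulo 2, their midpoint is on the
   boundary, and P has a side of length at least 2 in a primitive direction w; the
   opposite side is as long.  If P were higher than one lattice strip, it would have
   an interior lattice point on the next lattice line.  So P is in a strip, the points
   z + j w of a generic coset go through all four squares, and translation by w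
   permutes them cyclically: but this permutation is a word in h and v, hence even,
   while a 4-cycle is odd.

   If P is strictly convex, it is a centrally symmetric 2k-gon with opposite sides
   glued.  For even k all its vertices are identified, and for k = 3 they have angle
   2 pi, so k >= 5 as S has two singular points.  Then every vertex of P has angle
   more than 2 pi and is a lattice point, and in the tiling of P by the parallelograms
   on pairs of sides at least ten tiles meet each coset of Z^2: S has at least ten
   squares. *)

Require Import Defs.
From mathcomp Require Import all_boot all_order all_algebra all_fingroup.
From mathcomp Require Import reals.
From Stdlib Require Import Relation_Operators.
From mathcomp Require Import boolp classical_sets trigo ring lra zify.

Set Implicit Arguments.
Unset Strict Implicit.
Unset Printing Implicit Defensive.

Import Order.TTheory GRing.Theory Num.Theory.
Local Open Scope ring_scope.

(** The pieces of a cut-and-paste enter only through a relation [rel] between points of P and points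
    of S. It is multivalued along cuts and gluings, respects identifications in both directions, and
    moves short segments by one translation. The map to the torus is recovered from it by
    continuation along segments of P, which exist because P is convex. Angles of P are never summed.
    A cone angle larger than 2 pi is expressed by two rays that leave a point in the same direction
    without being identified; in P such rays must start at different boundary points, where
    identifications can be listed. Areas are avoided as well: squares are counted by the points over
    a generic coset of Z^2, and half-open squares make the square over such a point unique. At
    corners that square is ambiguous, so paths have to avoid them. Angles equal to pi shape the
    convex case: a side of P may consist of several edges glued in any order, so only the sum of
    their lengths can be compared with the opposite side. *)

Section PlaneLemmas.
Variable R : realType.
Implicit Types u v x y : R * R.

(** * Vectors of the plane and connectedness of the unit interval *)

Lemma addp1 u v : (u + v).1 = u.1 + v.1. Proof. by []. Qed.
Lemma addp2 u v : (u + v).2 = u.2 + v.2. Proof. by []. Qed.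
Lemma oppp1 u : (- u).1 = - u.1. Proof. by []. Qed.
Lemma oppp2 u : (- u).2 = - u.2. Proof. by []. Qed.
Lemma scalep1 t u : (scale t u).1 = t * u.1. Proof. by []. Qed.
Lemma scalep2 t u : (scale t u).2 = t * u.2. Proof. by []. Qed.
Definition coordE := (addp1, addp2, oppp1, oppp2, scalep1, scalep2).

Lemma pair_ext u v : u.1 = v.1 -> u.2 = v.2 -> u = v.
Proof. by case: u v => [? ?] [? ?] /= -> ->. Qed.

Lemma crossDr u v x : cross u (v + x) = cross u v + cross u x.
Proof. by rewrite /cross !coordE; ring. Qed.
Lemma crossBr u v x : cross u (v - x) = cross u v - cross u x.
Proof. by rewrite /cross !coordE; ring. Qed.
Lemma crossZr u t v : cross u (scale t v) = t * cross u v.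
Proof. by rewrite /cross !coordE; ring. Qed.
Lemma crossZl u t v : cross (scale t u) v = t * cross u v.
Proof. by rewrite /cross !coordE; ring. Qed.
Lemma crossNl u v : cross (- u) v = - cross u v.
Proof. by rewrite /cross !coordE; ring. Qed.
Lemma crossNr u v : cross u (- v) = - cross u v.
Proof. by rewrite /cross !coordE; ring. Qed.
Lemma crossC u v : cross v u = - cross u v.
Proof. by rewrite /cross; ring. Qed.
Lemma crossuu u : cross u u = 0.
Proof. by rewrite /cross; ring. Qed.

Lemma dot_gt0 u : u != 0 -> 0 < dot u u.
Proof.
case: u => a b; rewrite /dot /= => h.
rewrite lt_def addr_ge0 -?expr2 ?sqr_ge0 // andbT.
rewrite paddr_eq0 ?sqr_ge0 // !expf_eq0 /=.
by apply: contra h => /andP[/eqP -> /eqP ->].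
Qed.

Lemma cross0_scale u v : u != 0 -> cross u v = 0 ->
  v = scale (dot u v / dot u u) u.
Proof.
move=> u0; have := dot_gt0 u0; rewrite /cross /dot => d0 c0.
by apply: pair_ext; rewrite !coordE mulrAC; apply: (canRL (mulfK (lt0r_neq0 d0)));
  [have : v.1 * (u.1 * u.1 + u.2 * u.2) = (u.1 * v.1 + u.2 * v.2) * u.1 - u.2 * (u.1 * v.2 - u.2 * v.1) by ring | have : v.2 * (u.1 * u.1 + u.2 * u.2) = (u.1 * v.1 + u.2 * v.2) * u.2 + u.1 * (u.1 * v.2 - u.2 * v.1) by ring]; rewrite c0 => ->; ring.
Qed.

Lemma cross_trans0 u x y : u != 0 -> cross u x = 0 -> cross u y = 0 ->
  cross x y = 0.
Proof.
move=> u0 /(cross0_scale u0) -> /(cross0_scale u0) ->.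
by rewrite crossZl crossZr crossuu !mulr0.
Qed.

Lemma scale_eq0 t u : u != 0 -> scale t u = 0 -> t = 0.
Proof.
move=> u0 [h1 h2]; have := dot_gt0 u0; rewrite /dot => d0.
have : t * (u.1 * u.1 + u.2 * u.2) = 0.
  by rewrite mulrDr !mulrA h1 h2 !mul0r addr0.
by move/eqP; rewrite mulf_eq0 (gt_eqF d0) orbF => /eqP.
Qed.

Lemma cross_basis u v x : cross u v != 0 ->
  x = scale (cross x v / cross u v) u + scale (cross u x / cross u v) v.
Proof.
move=> d0; apply: pair_ext; rewrite !coordE; move: d0; rewrite /cross => d0; by field.
Qed.

(** Connectedness of [0, 1], for a property that is constant near each point. It replaces the
    lifting of paths: what holds at the start of a segment is carried to its end. *)
Lemma unit_interval_ind (Q : R -> Prop) :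
  (forall t, 0 <= t <= 1 -> exists2 e, 0 < e & forall t', 0 <= t' <= 1 ->
     `|t' - t| < e -> Q t <-> Q t') ->
  Q 0 -> Q 1.
Proof.
move=> loc Q0.
pose A : set R := fun t => 0 <= t <= 1 /\ forall s, 0 <= s <= t -> Q s.
have A0 : A 0.
  split; first by rewrite lexx ler01.
  by move=> s /andP[s0 s1]; have -> : s = 0 by apply/eqP; rewrite eq_le s0 s1.
have ubA : ubound A 1 by move=> t [/andP[]].
have supA : has_sup A by split; [exists 0 | exists 1].
set m := sup A.
have m01 : 0 <= m <= 1.
  apply/andP; split; first exact: (ub_le_sup (proj2 supA) A0).
  by apply: (ge_sup _ ubA); exists 0.
have [e e0 He] := loc _ m01.
have [a [a01 Aa] am] := sup_adherent e0 supA.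
have aLm : a <= m by apply: ub_le_sup; [case: supA | split].
have Qm : Q m.
  apply/(He a) => //; first by rewrite distrC ger0_norm ?subr_ge0 //; move: am; rewrite -/m; lra.
  by apply: Aa; rewrite lexx andbT; case/andP: a01.
have Qle s : 0 <= s <= 1 -> s < m + e -> Q s.
  move=> s01 sm; have [sa|sa] := leP s a; first by apply: Aa; case/andP: s01 => -> _.
  apply/(He s) => //; rewrite ltr_norml; move: am; rewrite -/m => am; apply/andP; split; lra.
have [m1|m1] := leP 1 m.
  by have -> : 1 = m by apply/eqP; rewrite eq_le m1; case/andP: m01.
pose b := Num.min 1 (m + e / 2).
have mb : m < b by rewrite lt_min m1 ltrDl divr_gt0.
have be : b < m + e by rewrite gt_min ltrD2l ltr_pdivrMr // mulr_natr mulr2n ltrDl e0 orbT.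
have b1 : b <= 1 by rewrite ge_min lexx.
have : A b.
  split; first by rewrite b1 andbT; case/andP: m01 => m0 _; lra.
  by move=> s /andP[s0 sb]; apply: Qle; rewrite ?s0; lra.
move=> /(ub_le_sup (proj2 supA)); rewrite -/m; lra.
Qed.

End PlaneLemmas.

(** * Convex polygons described by their edges *)

Section Polygons.
Variable R : realType.
Variable S : gluing R.
Implicit Types (e f : edge S) (A : face S) (x y : R * R).

Definition side e x : R := cross (edge_vec e) (x - start e).

Lemma side_conv e x y t :
  side e (x + scale t (y - x)) = (1 - t) * side e x + t * side e y.
Proof. by rewrite /side /cross !coordE; ring. Qed.

Lemma side_add e x y : side e (x + y) = side e x + cross (edge_vec e) y.
Proof. by rewrite /side /cross !coordE; ring. Qed.

Lemma region_conv A x y t : 0 <= t <= 1 -> region A x -> region A y ->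
  region A (x + scale t (y - x)).
Proof.
move=> /andP[t0 t1] rx ry e eA.
have := rx e eA; have := ry e eA; rewrite -!/(side _ _) => h1 h2.
by rewrite -/(side _ _) side_conv addr_ge0 // mulr_ge0 // subr_ge0.
Qed.

Lemma end_startE e : start (nxt e) = start e + edge_vec e.
Proof. by rewrite /edge_vec addrC subrK. Qed.

Definition interior A x := forall e, face_of e = A -> 0 < side e x.

Lemma interior_region A x : interior A x -> region A x.
Proof. by move=> h e /h /ltW. Qed.

Definition edge_point e t : face S * (R * R) :=
  (face_of e, start e + scale t (edge_vec e)).

Lemma side_edge_point e t : side e (edge_point e t).2 = 0.
Proof. by rewrite /side /edge_point /= /cross !coordE; ring. Qed.

Hypothesis convS : convex_polygons S.

Lemma nxt_inj : injective (@nxt R S). Proof. by case: convS. Qed.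

Lemma face_nxt e : face_of (nxt e) = face_of e.
Proof. by case: convS => _ h _ _ _; apply/eqP; rewrite eq_sym -h fconnect1. Qed.

Lemma region_start e f : face_of e = face_of f -> 0 <= side e (start f).
Proof. by move=> ef; case: convS => _ _ _ _ /(_ (face_of f))[h _]; apply: h. Qed.

Lemma start_inj e f : face_of e = face_of f -> start e = start f -> e = f.
Proof. by case: convS => _ _ _ h _; apply: h. Qed.

(** A zero edge would be its own successor, because the vertices of a face are distinct, and then
    the only edge of a degenerate face. *)
Lemma edge_vec_neq0 e : edge_vec e != 0.
Proof.
apply/eqP => e0.
have ne : nxt e = e.
  by apply: start_inj; rewrite ?face_nxt // end_startE e0 addr0.
have all_e f : face_of e = face_of f -> f = e.
  case: convS => _ h _ _ _ /eqP; rewrite -h => /iter_findex <-.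
  by elim: (findex _ _ _) => //= n ->.
case: convS => _ _ _ _ /(_ (face_of e))[_ [g [g' [ge _]]]].
by rewrite (all_e g) // e0 /cross !mul0r subr0 ltxx.
Qed.

Lemma not_all_on_line e : ~ forall f, face_of f = face_of e -> side e (start f) = 0.
Proof.
move=> line; case: convS => _ _ _ _ /(_ (face_of e))[_ [g [g' [ge g'e]]]].
have := edge_vec_neq0 e => e0.
have c0 f f' : face_of f = face_of e -> face_of f' = face_of e ->
    cross (edge_vec e) (start f - start f') = 0.
  move=> /line h1 /line h2; move: h1 h2; rewrite /side /cross !coordE; lra.
rewrite (cross_trans0 e0) ?ltxx //; last exact: c0.
by rewrite [edge_vec g]/edge_vec c0 // face_nxt.
Qed.

(** Each of two opposite edges on one line confines the polygon to its left, so together they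
    squeeze it into that line. *)
Lemma no_antiparallel e f r : face_of e = face_of f -> side e (start f) = 0 ->
  edge_vec f = scale r (edge_vec e) -> r < 0 -> False.
Proof.
move=> ef sf fr r0; apply: (@not_all_on_line e) => g ge.
have := region_start (esym ge); have : 0 <= side f (start g).
  by apply: region_start; rewrite ge.
rewrite {1}/side fr crossZl nmulr_rge0 //.
have -> : start g - start f = (start g - start e) - (start f - start e).
  by apply: pair_ext; rewrite !coordE; ring.
rewrite crossBr -/(side _ _) -/(side _ _) sf subr0 => h1 h2.
by apply/eqP; rewrite eq_le h1 h2.
Qed.

Lemma collinear_edges e f : face_of e = face_of f -> side e (start f) = 0 ->
  cross (edge_vec e) (edge_vec f) = 0 ->
  exists2 r, 0 < r & edge_vec f = scale r (edge_vec e).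
Proof.
move=> ef sf c0; have fr := cross0_scale (edge_vec_neq0 e) c0.
set r := _ / _ in fr; exists r => //.
rewrite lt_neqAle eq_sym; apply/andP; split; last first.
  by rewrite leNgt; apply/negP => /(no_antiparallel ef sf fr).
apply/eqP => r0; have := edge_vec_neq0 f; rewrite fr r0.
by case/negP; apply/eqP/pair_ext; rewrite !coordE mul0r.
Qed.

(** Every straight side is a single edge. Unit squares and strictly convex polygons satisfy this,
    and it is the form in which strictness enters the classification of identified points. *)
Definition parallel_unique := forall e f r, face_of e = face_of f -> 0 < r ->
  edge_vec f = scale r (edge_vec e) -> e = f.

Hypothesis pu : parallel_unique.

(** [side f] is nonnegative at both ends of [e]; vanishing strictly between them, it vanishes at
    both, so [e] and [f] lie on one line and have the same direction. *)
Lemma edge_point_inj e f t s : 0 < t < 1 -> 0 <= s <= 1 ->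
  edge_point e t = edge_point f s -> e = f /\ t = s.
Proof.
move=> /andP[t0 t1] s01 pq; have ef : face_of e = face_of f := congr1 fst pq.
have {pq} pts := congr1 snd pq; rewrite /= in pts.
have side0 : side f (start e + scale t (edge_vec e)) = 0.
  by rewrite pts; exact: (side_edge_point f s).
have a0 := region_start (esym ef).
have b0 : 0 <= side f (start (nxt e)) by apply: region_start; rewrite face_nxt.
have e1 : (1 - t) * side f (start e) + t * side f (start (nxt e)) = 0.
  by rewrite -side_conv -/(edge_vec e).
have [sa sb] : side f (start e) = 0 /\ side f (start (nxt e)) = 0.
  have u : 0 <= (1 - t) * side f (start e) by rewrite mulr_ge0 // subr_ge0 ltW.
  have v : 0 <= t * side f (start (nxt e)) by rewrite mulr_ge0 // ltW.
  have /eqP : (1 - t) * side f (start e) = 0 by lra.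
  have /eqP : t * side f (start (nxt e)) = 0 by lra.
  have t1' : 0 < 1 - t by rewrite subr_gt0.
  rewrite !mulf_eq0 (gt_eqF t0) (gt_eqF t1') /=.
  by move=> /eqP -> /eqP ->.
have c0 : cross (edge_vec f) (edge_vec e) = 0.
  by move: sb; rewrite end_startE side_add sa add0r.
have [r r0 er] := collinear_edges (esym ef) sa c0.
have fe := pu (esym ef) r0 er; subst f; split => //.
apply/eqP; rewrite -subr_eq0; apply/eqP; apply: (scale_eq0 (edge_vec_neq0 e)).
have := pts => /(congr1 (fun z => z - (start e + scale s (edge_vec e)))).
by rewrite subrr => <-; apply: pair_ext; rewrite !coordE; ring.
Qed.

End Polygons.

(** * Classification of identified points *)

Section SamePoint.
Variable R : realType.
Variable S : gluing R.
Implicit Types (e f : edge S) (A : face S) (x y : R * R) (p q : face S * (R * R)).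

Hypothesis glS : translation_gluing S.

Lemma glueK : involutive (@glue R S). Proof. by case: glS. Qed.
Lemma edge_vec_glue e : edge_vec (glue e) = - edge_vec e. Proof. by case: glS. Qed.

Lemma gluedE p q : glued p q <-> exists e t, [/\ 0 <= t <= 1,
  p = edge_point e t & q = edge_point (glue e) (1 - t)].
Proof.
split=> -[e [t [t01 -> ->]]]; exists e, t; split=> //; congr pair;
  rewrite end_startE edge_vec_glue; apply: pair_ext; rewrite !coordE; ring.
Qed.

Lemma same_sym p q : same_point p q -> same_point q p.
Proof. exact: rst_sym. Qed.
Lemma same_trans p q r : same_point p q -> same_point q r -> same_point p r.
Proof. exact: rst_trans. Qed.
Lemma same_refl p : same_point p p.
Proof. exact: rst_refl. Qed.

Lemma same_edge_point e t : 0 <= t <= 1 ->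
  same_point (edge_point e t) (edge_point (glue e) (1 - t)).
Proof. by move=> t01; apply: rst_step; apply/gluedE; exists e, t. Qed.

(** No generator of [same_point] touches an interior point, since such a point lies on no edge.
    Being equal to [(A, x)] is therefore invariant under identification, and in this form the
    induction passes through symmetry and transitivity. *)
Lemma same_interior A x q : interior A x -> same_point (A, x) q -> q = (A, x).
Proof.
move=> intx.
have not_edge e t : (A, x) <> edge_point e t.
  move=> h; have [eA eB] : face_of e = A /\ x = (edge_point e t).2 by rewrite -h; case: h.
  by have := intx e eA; rewrite eB side_edge_point ltxx.
suff H p r : same_point p r -> (p = (A, x) <-> r = (A, x)).
  by move=> /H h; apply/h.
elim=> {p q r} [p q /gluedE [e [t [_ -> ->]]]|p|p q _ h|p q r _ h1 _ h2].
- by split=> h; have := not_edge _ _ (esym h).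
- by [].
- by split=> /h.
- by split; [move=> /h1 /h2|move=> /h2 /h1].
Qed.

Hypothesis convS : convex_polygons S.

Lemma around_inj : injective (@around R S).
Proof. by move=> e f /(can_inj glueK) /(nxt_inj convS). Qed.

Hypothesis pu : parallel_unique S.

Definition vertex_point e : face S * (R * R) := (face_of e, start (nxt e)).

Variant same_spec p q : Prop :=
| SameEq of p = q
| SameEdge e t of 0 < t < 1 & p = edge_point e t & q = edge_point (glue e) (1 - t)
| SameVertex e f of fconnect (@around R S) e f & p = vertex_point e & q = vertex_point f.

Lemma vertex_pointE e : vertex_point e = edge_point e 1.
Proof.
by congr pair; rewrite end_startE; apply: pair_ext; rewrite !coordE mul1r.
Qed.

Lemma vertex_point_nxt e : vertex_point e = edge_point (nxt e) 0.
Proof.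
rewrite /vertex_point /edge_point (face_nxt convS); congr pair.
by apply: pair_ext; rewrite !coordE mul0r addr0.
Qed.

Lemma vertex_point_inj e f : vertex_point e = vertex_point f -> e = f.
Proof.
by case=> ef se; apply: (nxt_inj convS); apply: (start_inj convS); rewrite ?(face_nxt convS).
Qed.

Lemma edge_vertex_neq e t f : 0 < t < 1 -> edge_point e t <> vertex_point f.
Proof.
move=> t01; rewrite vertex_pointE => /(edge_point_inj convS pu t01).
by rewrite ler01 lexx => /(_ isT)[_ t1]; move: t01; rewrite t1 ltxx andbF.
Qed.

(** The three cases are closed under composition: a point strictly inside an edge is involved in the
    gluing of that edge only, and at vertices the gluings follow [around]. A gluing at parameter 0
    or 1 already belongs to the vertex case. *)
Lemma same_pointP p q : same_point p q -> same_spec p q.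
Proof.
have oneB (t : R) : 0 < t < 1 -> 0 < 1 - t < 1.
  by move=> /andP[t0 t1]; apply/andP; split; lra.
elim=> {p q} [p q /gluedE [e [t [/andP[t0 t1] pE qE]]]|p|p q _ h|p q r _ h1 _ h2].
- move: t0; rewrite le_eqVlt => /orP[/eqP t0|t0].
    have [e' ee'] : exists e', nxt e' = e.
      by exists (finv (@nxt R S) e); rewrite f_finv //; apply: nxt_inj.
    apply: (@SameVertex _ _ e' (glue e)).
    + by rewrite -ee' -/(around e') fconnect1.
    + by rewrite pE -t0 vertex_point_nxt ee'.
    + by rewrite qE -t0 subr0 vertex_pointE.
  move: t1; rewrite le_eqVlt => /orP[/eqP t1|t1].
    have [e' ee'] : exists e', nxt e' = glue e.
      by exists (finv (@nxt R S) (glue e)); rewrite f_finv //; apply: nxt_inj.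
    apply: (@SameVertex _ _ e e').
    + rewrite (fconnect_sym around_inj) -[X in fconnect _ _ X]glueK -ee'.
      by rewrite -/(around e') fconnect1.
    + by rewrite pE t1 vertex_pointE.
    + by rewrite qE t1 subrr vertex_point_nxt ee'.
  by apply: (@SameEdge _ _ e t) => //; rewrite t0.
- exact: SameEq.
- case: h => [->|e t t01 -> ->|e f ef -> ->].
  + exact: SameEq.
  + by apply: (@SameEdge _ _ (glue e) (1 - t)); rewrite ?glueK ?oneB //; congr edge_point; ring.
  + by apply: (@SameVertex _ _ f e) => //; rewrite (fconnect_sym around_inj).
- case: h1 => [->//|e t t01 pE qE|e f ef pE qE].
    case: h2 => [<-|e' t' t01' qE' rE|e' f' _ qE' _].
    + exact: (@SameEdge _ _ e t).
    + move: qE'; rewrite qE => /(edge_point_inj convS pu (oneB _ t01)).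
      have t1 : 0 <= t' <= 1 by case/andP: t01' => a b; rewrite !ltW.
      move=> /(_ t1)[he ht]; apply: SameEq; rewrite pE rE -he -ht glueK.
      by congr edge_point; ring.
    + by have := edge_vertex_neq (oneB _ t01); move/(_ (glue e) e'); rewrite -qE.
  case: h2 => [<-|e' t' t01' qE' rE|e' f' ef' qE' rE].
  + exact: (@SameVertex _ _ e f).
  + by have := edge_vertex_neq t01'; move/(_ e' f); rewrite -qE'.
  + have ff : f = e' by apply: vertex_point_inj; rewrite -qE.
    by apply: (@SameVertex _ _ e f') => //; apply: connect_trans ef _; rewrite ff.
Qed.

Lemma same_vertex e f : fconnect (@around R S) e f ->
  same_point (vertex_point e) (vertex_point f).
Proof.
move=> /iter_findex <-; elim: (findex _ _ _) => [|n IH] /=; first exact: same_refl.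
apply: same_trans IH _; rewrite vertex_point_nxt vertex_pointE.
have := @same_edge_point (nxt (iter n (@around R S) e)) 0.
by rewrite lexx ler01 subr0; apply.
Qed.

(* A direction pointing inwards on both sides of an edge must be parallel to it,
   so the two paths run along the edge and stay glued. *)
Lemma fold_germ A x A' x' u t0 : 0 < t0 ->
  (forall e, (A, x) <> vertex_point e) ->
  same_point (A, x) (A', x') ->
  region A (x + scale t0 u) -> region A' (x' + scale t0 u) ->
  exists2 t1, 0 < t1 & forall t, 0 <= t <= t1 ->
    same_point (A, x + scale t u) (A', x' + scale t u).
Proof.
move=> t0_gt0 nv /same_pointP[[<- <-]|e s s01 pE qE|e f _ pE]; last by have := nv e.
  by exists 1 => // t _; apply: same_refl.
move: pE qE => [AE xE] [AE' xE'] rA rA'.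
have : 0 <= t0 * cross (edge_vec e) u.
  have := rA e (esym AE); rewrite xE -/(side _ _) side_add (side_edge_point e s).
  by rewrite add0r crossZr.
have : 0 <= - (t0 * cross (edge_vec e) u).
  have := rA' (glue e) (esym AE'); rewrite xE' -/(side _ _) side_add.
  rewrite (side_edge_point (glue e) (1 - s)).
  by rewrite add0r crossZr edge_vec_glue crossNl mulrN.
move=> h1 h2; have c0 : cross (edge_vec e) u = 0.
  have /eqP : t0 * cross (edge_vec e) u = 0 by lra.
  by rewrite mulf_eq0 (gt_eqF t0_gt0) => /eqP.
have uE := cross0_scale (edge_vec_neq0 convS e) c0; set r := _ / _ in uE.
case/andP: s01 => s0 s1.
exists (Num.min s (1 - s) / (1 + `|r|)).
  by rewrite divr_gt0 ?lt_min ?s0 ?subr_gt0 ?ltr_wpDr.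
move=> t /andP[tge tle].
have rp : 0 < 1 + `|r| by rewrite ltr_wpDr.
move: tle; rewrite ler_pdivlMr // le_min => /andP[k1 k2].
have n1 : `|t * r| <= t * (1 + `|r|).
  by rewrite normrM (ger0_norm tge) ler_wpM2l // lerDr.
have b1 := le_trans (ler_norm _) n1.
have b2 : - (t * r) <= t * (1 + `|r|) by rewrite -normrN in n1; apply: le_trans (ler_norm _) n1.
have := @same_edge_point e (s + t * r).
have -> : 0 <= s + t * r <= 1 by apply/andP; split; lra.
move/(_ isT); congr same_point.
  by rewrite /edge_point AE xE uE; congr pair; apply: pair_ext; rewrite !coordE; ring.
rewrite /edge_point AE' xE' uE edge_vec_glue.
by congr pair; apply: pair_ext; rewrite !coordE; ring.
Qed.

End SamePoint.

(** * Cut-and-paste as a relation between points *)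

Section FiniteEps.
Variable R : realType.

Lemma finite_eps (I : finType) (P : I -> R -> Prop) :
  (forall i e e', 0 < e' -> e' <= e -> P i e -> P i e') ->
  (forall i, exists2 e, 0 < e & P i e) ->
  exists2 e, 0 < e & forall i, P i e.
Proof.
move=> mono ex.
suff [e e0 He] : exists2 e, 0 < e & forall i, i \in enum I -> P i e.
  by exists e => // i; apply: He; rewrite mem_enum.
elim: (enum I) => [|i s [e e0 He]]; first by exists 1.
have [e' e'0 He'] := ex i; exists (Num.min e e'); first by rewrite lt_min e0.
move=> j; rewrite inE => /orP[/eqP ->|/He].
  by apply: mono He'; rewrite ?lt_min ?e0 // ge_min lexx orbT.
by apply: mono; rewrite ?lt_min ?e0 // ge_min lexx.
Qed.
End FiniteEps.

Section Correspondence.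
Variable R : realType.
Implicit Types X Y U P S : gluing R.

Definition near (e : R) (x x' : R * R) := `|x'.1 - x.1| < e /\ `|x'.2 - x.2| < e.

(** What remains of a cut-and-paste when the pieces are forgotten. In [corr_local], [x] and a nearby
    [x'] lie in a common piece, whose translation [c] serves the whole segment between them. *)
Record correspondence X Y (rel : face X * (R * R) -> face Y * (R * R) -> Prop) := {
  corr_total : forall A x, region A x -> exists q, rel (A, x) q;
  corr_region : forall A x B y, rel (A, x) (B, y) -> region A x /\ region B y;
  corr_same : forall p q p' q', rel p q -> rel p' q' ->
    (same_point p p' <-> same_point q q');
  corr_local : forall A x, region A x -> exists2 e, 0 < e &
    forall x', region A x' -> near e x x' -> exists B c, forall s, 0 <= s <= 1 ->
      rel (A, x + scale s (x' - x)) (B, x + scale s (x' - x) + c) }.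

Lemma region_closed S (A : face S) x : ~ region A x ->
  exists2 e, 0 < e & forall x', near e x x' -> ~ region A x'.
Proof.
move=> /existsNP [f /not_implyP [fA /negP]]; rewrite -ltNge -/(side f x) => neg.
set v := edge_vec f; have v1 := normr_ge0 v.1; have v2 := normr_ge0 v.2.
have d0 : 0 < 1 + `|v.1| + `|v.2| by lra.
exists (- side f x / (1 + `|v.1| + `|v.2|)); first by rewrite divr_gt0 // oppr_gt0.
move=> x' [n1 n2] /(_ f fA); rewrite -/(side f x') leNgt => /negP; apply.
have -> : side f x' = side f x + (v.1 * (x'.2 - x.2) - v.2 * (x'.1 - x.1)).
  by rewrite /side /cross -/v !coordE; ring.
move: n1 n2; set e := _ / _ => n1 n2.
have e0 : 0 < e by rewrite divr_gt0 // oppr_gt0.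
have eE : e * (1 + `|v.1| + `|v.2|) = - side f x by rewrite divfK // gt_eqF.
have k1 : v.1 * (x'.2 - x.2) <= `|v.1| * e.
  by apply: le_trans (ler_norm _) _; rewrite normrM ler_wpM2l // ltW.
have k2 : - (v.2 * (x'.1 - x.1)) <= `|v.2| * e.
  by apply: le_trans (ler_norm _) _; rewrite normrN normrM ler_wpM2l // ltW.
have : e * (1 + `|v.1| + `|v.2|) = e + `|v.1| * e + `|v.2| * e by ring.
lra.
Qed.

(** The pieces are closed, convex and finite in number: close to a point only pieces containing that
    point occur, and such a piece contains the segment to any other of its points. *)
Lemma cutting_correspondence U X Y phi tr phi' tr' :
  (forall A x, region A x -> region (phi A) (x + tr A)) ->
  (forall (B : face X) y, region B y ->
     exists A x, [/\ region A x, phi A = B & x + tr A = y]) ->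
  (forall A x A' x', region A x -> region A' x' ->
    (same_point (A, x) (A', x') <->
     same_point (phi A, x + tr A) (phi A', x' + tr A'))) ->
  (forall A x, region A x -> region (phi' A) (x + tr' A)) ->
  (forall A x A' x', region A x -> region A' x' ->
    (same_point (A, x) (A', x') <->
     same_point (phi' A, x + tr' A) (phi' A', x' + tr' A'))) ->
  @correspondence X Y (fun p q => exists (A : face U) x,
    [/\ region A x, p = (phi A, x + tr A) & q = (phi' A, x + tr' A)]).
Proof.
move=> reg tot sm reg' sm'; split.
- move=> B y /tot[A [x [rx pA <-]]]; exists (phi' A, x + tr' A).
  by exists A, x; rewrite -pA.
- move=> B y B' y' [A [x [rx [-> ->] [-> ->]]]]; split; [exact: reg|exact: reg'].
- move=> p q p' q' [A [x [rx -> ->]]] [A' [x' [rx' -> ->]]].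
  by rewrite -sm // -sm'.
- move=> B y ry.
  (* A radius is good for a piece if a piece that misses [y] also misses the neighbourhood of [y] of
     this radius. *)
  pose good (A : face U) e := ~ region A (y - tr A) ->
    forall y', near e y y' -> ~ region A (y' - tr A).
  have [|A|e e0 He] := @finite_eps R (face U) good.
  + move=> A e e' e'0 ee' h nr y' [n1 n2]; apply: h => //.
    by split; [apply: lt_le_trans n1 _|apply: lt_le_trans n2 _].
  + have [r|nr] := pselect (region A (y - tr A)); first by exists 1.
    have [e e0 He] := region_closed nr; exists e => // _ y' [n1 n2]; apply: He.
    have sh (a b c : R) : a - b - (c - b) = a - c by ring.
    by split; rewrite !coordE sh.
  exists e => // y' ry' ny; have [A [x' [rx' pA xy']]] := tot _ _ ry'.
  have xE : x' = y' - tr A by rewrite -xy' addrK.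
  have rx : region A (y - tr A).
    by apply: contrapT => /He /(_ _ ny); rewrite -xE.
  exists (phi' A), (tr' A - tr A) => s s01.
  exists A, (y - tr A + scale s (x' - (y - tr A))); split.
  + exact: region_conv.
  + by rewrite pA; congr pair; rewrite xE; apply: pair_ext; rewrite !coordE; ring.
  + by congr pair; rewrite xE; apply: pair_ext; rewrite !coordE; ring.
Qed.

Lemma cut_and_paste_correspondence P S : cut_and_paste P S ->
  exists rel, correspondence rel /\ @correspondence S P (fun p q => rel q p).
Proof.
move=> [U [_ [phi [tr [a b c]]] [phi' [tr' [a' b' c']]]]].
exists (fun p q => exists (A : face U) x,
    [/\ region A x, p = (phi A, x + tr A) & q = (phi' A, x + tr' A)]).
split; first exact: cutting_correspondence.
have := cutting_correspondence a' b' c' a c; congr correspondence.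
by apply: funext => p; apply: funext => q; apply: propext; split=> -[A [x [? ? ?]]]; exists A, x.
Qed.

Lemma small_scale (u : R * R) (e : R) : 0 < e ->
  exists2 t0, 0 < t0 & forall t, 0 <= t <= t0 -> `|t * u.1| < e /\ `|t * u.2| < e.
Proof.
move=> e0; have v1 := normr_ge0 u.1; have v2 := normr_ge0 u.2.
have d0 : 0 < 1 + `|u.1| + `|u.2| by lra.
exists (e / 2 / (1 + `|u.1| + `|u.2|)); first by rewrite !divr_gt0.
move=> t /andP[t0]; rewrite ler_pdivlMr // => tle.
have w1 : 0 <= t * `|u.1| by rewrite mulr_ge0.
have w2 : 0 <= t * `|u.2| by rewrite mulr_ge0.
by split; rewrite normrM (ger0_norm t0); lra.
Qed.

(** [corr_local] is applied to the far end of a segment, shortened until it is near [x]: the germ of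
    a ray is moved by one translation. *)
Lemma corr_ray X Y rel (A : face X) x u t0 : @correspondence X Y rel ->
  region A x -> 0 < t0 -> region A (x + scale t0 u) ->
  exists2 t1, 0 < t1 <= t0 & exists B y, forall t, 0 <= t <= t1 ->
    rel (A, x + scale t u) (B, y + scale t u).
Proof.
move=> cr rx t0_gt0 ru; have [e e0 He] := corr_local cr rx.
have [t1 t1_gt0 Ht1] := small_scale u e0.
pose t2 := Num.min t0 t1.
have t2_gt0 : 0 < t2 by rewrite lt_min t0_gt0.
have t2t0 : t2 <= t0 by rewrite ge_min lexx.
exists t2; first by rewrite t2_gt0.
have r2 : region A (x + scale t2 u).
  have -> : x + scale t2 u = x + scale (t2 / t0) (x + scale t0 u - x).
    by apply: pair_ext; rewrite !coordE; field; rewrite gt_eqF.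
  apply: region_conv => //; rewrite divr_ge0 ?(ltW t2_gt0) ?(ltW t0_gt0) //=.
  by rewrite ler_pdivrMr // mul1r.
have [|B [c Hc]] := He _ r2.
  have [|h1 h2] := Ht1 t2; first by rewrite (ltW t2_gt0) ge_min lexx orbT.
  by split; rewrite !coordE addrAC subrr add0r.
exists B, (x + c) => t /andP[t_ge0 tt2].
have := Hc (t / t2); rewrite divr_ge0 ?(ltW t2_gt0) //= ler_pdivrMr // mul1r => /(_ tt2).
have -> : x + scale (t / t2) (x + scale t2 u - x) = x + scale t u.
  by apply: pair_ext; rewrite !coordE; field; rewrite gt_eqF.
by congr rel; congr pair; apply: pair_ext; rewrite !coordE; ring.
Qed.

End Correspondence.

(** * Unit squares as polygons *)

Section Squares.
Variable R : realType.
Variable n : nat.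
Variables h v : {perm 'I_n}.
Let SQ := square_tiled R h v.
Implicit Types (i j : 'I_n) (k : 'I_4) (x y : R * R).

Definition square_side k : R * R :=
  match val k with
  | 0%N => (1, 0)
  | 1%N => (0, 1)
  | 2%N => (-1, 0)
  | _ => (0, -1)
  end.

Lemma ord4_ind (Q : 'I_4 -> Prop) :
  Q (@inord 3 0) -> Q (@inord 3 1) -> Q (@inord 3 2) -> Q (@inord 3 3) -> forall k, Q k.
Proof.
move=> q0 q1 q2 q3 k; rewrite -(inord_val k).
by case: k => [[|[|[|[|m]]]] hm].
Qed.

Lemma ordS_inord m : (m < 4)%N -> ordS (@inord 3 m) = @inord 3 (m.+1 %% 4).
Proof. by move=> m4; apply: val_inj; rewrite /= !inordK // ltn_mod. Qed.

Lemma square_edge_vec i k : edge_vec ((i, k) : edge SQ) = square_side k.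
Proof.
rewrite /edge_vec /=; elim/ord4_ind: k; rewrite ordS_inord //;
  rewrite /square_corner /square_side /= !inordK //=;
  by apply: pair_ext; rewrite !coordE /=; ring.
Qed.

Lemma square_sideE i k x : side ((i, k) : edge SQ) x =
  match val k with 0%N => x.2 | 1%N => 1 - x.1 | 2%N => 1 - x.2 | _ => x.1 end.
Proof.
rewrite /side square_edge_vec /cross !coordE /=.
by elim/ord4_ind: k; rewrite /square_corner /square_side /= !inordK //=; ring.
Qed.

Lemma square_sides (Q : R -> Prop) i x :
  (forall e : edge SQ, face_of e = i -> Q (side e x)) <->
  [/\ Q x.1, Q (1 - x.1), Q x.2 & Q (1 - x.2)].
Proof.
split=> [H|[q1 q2 q3 q4] [j k] _]; last first.
  by rewrite square_sideE; elim/ord4_ind: k; rewrite /= !inordK.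
have E m : Q (side ((i, @inord 3 m) : edge SQ) x) by apply: H.
move: (E 0%N) (E 1%N) (E 2%N) (E 3%N); rewrite !square_sideE /= !inordK //=.
Qed.

Lemma square_region i x : @region R SQ i x <-> 0 <= x.1 <= 1 /\ 0 <= x.2 <= 1.
Proof.
apply: (iff_trans (square_sides (fun r => 0 <= r) i x)); rewrite !subr_ge0.
by split=> [[-> -> -> ->]|[/andP[? ?] /andP[? ?]]].
Qed.

Lemma square_interior i x : @interior R SQ i x <-> 0 < x.1 < 1 /\ 0 < x.2 < 1.
Proof.
apply: (iff_trans (square_sides (fun r => 0 < r) i x)); rewrite !subr_gt0.
by split=> [[-> -> -> ->]|[/andP[? ?] /andP[? ?]]].
Qed.

Lemma iter_square_nxt m i k : iter m (@nxt R SQ) (i, k) = (i, iter m (@ordS 4) k).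
Proof. by elim: m => //= m ->. Qed.

Lemma iter_ordS m k : val (iter m (@ordS 4) k) = ((k + m) %% 4)%N.
Proof.
elim: m => [|m IH]; first by rewrite addn0 modn_small.
rewrite /= -[X in (X.+1 %% 4)%N]/(val (iter m (@ordS 4) k)) IH.
by rewrite -addn1 modnDml addn1 addnS.
Qed.

Lemma square_corner_range k : 0 <= (square_corner R k).1 <= 1 /\ 0 <= (square_corner R k).2 <= 1.
Proof. by elim/ord4_ind: k; rewrite /square_corner /= !inordK //= !lexx !ler01. Qed.

Lemma square_convex : convex_polygons SQ.
Proof.
split.
- move=> [i k] [j l] E; have /= -> := congr1 fst E.
  by have /(@ordS_inj 4) -> : ordS k = ordS l := congr1 snd E.
- move=> [i k] [j l]; apply/idP/eqP => /= [c|<-].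
    by have := iter_findex c; rewrite iter_square_nxt => -[].
  have -> : (i, l) = iter (l + (4 - k))%N (@nxt R SQ) (i, k).
    rewrite iter_square_nxt; congr pair; apply: val_inj; rewrite iter_ordS.
    by rewrite addnCA subnKC ?(ltnW (ltn_ord k)) // modnDr modn_small.
  exact: fconnect_iter.
- by move=> i; exists (i, ord0).
- move=> [i k] [j l] /= ->; move: k l; elim/ord4_ind; elim/ord4_ind => //;
    rewrite /square_corner /= !inordK //= => -[] /eqP; rewrite ?oner_eq0 // eq_sym ?oner_eq0 //;
    move=> _ /eqP; rewrite ?oner_eq0 // eq_sym ?oner_eq0 //.
- move=> i; split=> [[j k] _|].
    by apply/square_region; exact: square_corner_range.
  exists (i, @inord 3 0), (i, @inord 3 2); split => //.
  rewrite square_edge_vec /= /square_side /square_corner /= !inordK //= /cross !coordE /=.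
  by rewrite mul1r mul0r !subr0 ltr01.
Qed.

Lemma ordSS_ordSS k : ordS (ordS (ordS (ordS k))) = k.
Proof. by elim/ord4_ind: k; rewrite !ordS_inord. Qed.

Lemma square_glue : translation_gluing SQ.
Proof.
split=> [[i k]|[i k]] /=.
  rewrite /= ordSS_ordSS; congr pair.
  by elim/ord4_ind: k; rewrite !ordS_inord // /neighbour /= !inordK //= ?permK ?permKV.
rewrite !square_edge_vec.
elim/ord4_ind: k; rewrite !ordS_inord // /square_side /= !inordK //=;
  by apply: pair_ext; rewrite !coordE /= ?oppr0 ?opprK.
Qed.

Lemma square_parallel_unique : parallel_unique SQ.
Proof.
move=> [i k] [j l] r /= -> r0; rewrite !square_edge_vec => E; congr pair.
move: E; move: k l; elim/ord4_ind; elim/ord4_ind => //;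
  rewrite /square_side /= !inordK //= => -[] /= e1 e2; exfalso; lra.
Qed.

End Squares.

(** * Integer points *)

Section IntPoints.
Variable R : realType.
Implicit Types x y : R * R.

Definition intp x := (x.1 \is a Num.int) && (x.2 \is a Num.int).

Lemma intp0 : intp 0. Proof. by rewrite /intp !rpred0. Qed.
Lemma intpD x y : intp x -> intp y -> intp (x + y).
Proof. by rewrite /intp => /andP[a b] /andP[c d]; rewrite !rpredD. Qed.
Lemma intpN x : intp (- x) = intp x.
Proof. by rewrite /intp !rpredN. Qed.
Lemma intpB x y : intp x -> intp y -> intp (x - y).
Proof. by move=> ix iy; rewrite intpD ?intpN. Qed.
Lemma intp_cross x y : intp x -> intp y -> cross x y \is a Num.int.
Proof. by move=> /andP[a b] /andP[c d]; rewrite /cross rpredB ?rpredM. Qed.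

Lemma int_small (a : R) : a \is a Num.int -> -1 < a < 1 -> a = 0.
Proof.
move=> ia a1; apply/eqP; apply: contraTT a1 => /(norm_intr_ge1 ia).
by rewrite -ltr_norml -leNgt.
Qed.

Lemma int_ge1 (a : R) : a \is a Num.int -> 0 < a -> 1 <= a.
Proof. by move=> ia a0; rewrite -(gtr0_norm a0); apply: norm_intr_ge1; rewrite ?gt_eqF. Qed.

Lemma int01 (a : R) : a \is a Num.int -> 0 <= a <= 1 -> a = 0 \/ a = 1.
Proof.
move=> ia /andP[]; rewrite le_eqVlt => /orP[/eqP <-|]; first by left.
by move=> /(int_ge1 ia) h1 h2; right; apply/eqP; rewrite eq_le h1 h2.
Qed.

Lemma floor01 (a : R) : 0 <= a <= 1 -> Num.floor a = (a == 1)%:R.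
Proof.
move=> /andP[a0 a1]; have [->|n1] := eqVneq a 1; first by rewrite floor1.
by apply/floor_def; rewrite a0 add0r lt_neqAle n1 a1.
Qed.
End IntPoints.

(** * The square that contains a point, and how it changes along short paths *)

Section Squares.
Variable R : realType.
Variable n : nat.
Variables h v : {perm 'I_n}.
Notation SQ := (square_tiled R h v).
Implicit Types (i j : 'I_n) (k : 'I_4) (x y : R * R).

(** Coordinates modulo Z^2 are compatible with the gluings; this is the map from the square-tiled
    surface to the torus. *)
Lemma same_congr (p q : face SQ * (R * R)) : same_point p q -> intp (p.2 - q.2).
Proof.
elim=> {p q} [p q /(gluedE (@square_glue R n h v)) [[i k] [t [t01 -> ->]]]|p|p q _ IH|p q r _ h1 _ h2].
- rewrite /edge_point /= !square_edge_vec.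
  elim/ord4_ind: k; rewrite !ordS_inord // /square_corner /square_side /= !inordK //=;
    set d := (X in intp X).
  + have -> : d = (0, -1) by apply: pair_ext; rewrite !coordE /=; ring.
    by rewrite /intp rpred0 rpredN1.
  + have -> : d = (1, 0) by apply: pair_ext; rewrite !coordE /=; ring.
    by rewrite /intp rpred0 rpred1.
  + have -> : d = (0, 1) by apply: pair_ext; rewrite !coordE /=; ring.
    by rewrite /intp rpred0 rpred1.
  + have -> : d = (-1, 0) by apply: pair_ext; rewrite !coordE /=; ring.
    by rewrite /intp rpred0 rpredN1.
- by rewrite subrr intp0.
- by rewrite -intpN opprB.
- by rewrite -(subrK q.2 p.2) -addrA intpD.
Qed.

Lemma same_right i b : 0 <= b <= 1 -> @same_point R SQ (i, (1, b)) (h i, (0, b)).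
Proof.
move=> b01; have := same_edge_point (@square_glue R n h v) ((i, @inord 3 1) : edge SQ) b01.
congr same_point; rewrite /edge_point /=; congr pair.
- by rewrite square_edge_vec /square_corner /square_side /= !inordK //=; apply: pair_ext; rewrite !coordE /=; ring.
- by rewrite /neighbour /= inordK.
- rewrite square_edge_vec !ordS_inord // /square_corner /square_side /= !inordK //=.
  by apply: pair_ext; rewrite !coordE /=; ring.
Qed.

Lemma same_top i a : 0 <= a <= 1 -> @same_point R SQ (i, (a, 1)) (v i, (a, 0)).
Proof.
move=> a01; have a01' : 0 <= 1 - a <= 1 by case/andP: a01 => a0 a1; apply/andP; split; lra.
have := same_edge_point (@square_glue R n h v) ((i, @inord 3 2) : edge SQ) a01'.
congr same_point; rewrite /edge_point /=; congr pair.
- by rewrite square_edge_vec /square_corner /square_side /= !inordK //=; apply: pair_ext; rewrite !coordE /=; ring.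
- by rewrite /neighbour /= inordK.
- rewrite square_edge_vec !ordS_inord // /square_corner /square_side /= !inordK //=.
  by apply: pair_ext; rewrite !coordE /=; ring.
Qed.

Lemma square_vertex_int (e : edge SQ) : intp (vertex_point e).2.
Proof.
case: e => i k; rewrite /vertex_point /= /intp /square_corner.
by elim/ord4_ind: k; rewrite ordS_inord // /= !inordK //= ?rpred0 ?rpred1.
Qed.

Definition half_open x := (0 <= x.1 < 1) && (0 <= x.2 < 1).

(** A gluing joins a right or top side to a left or bottom one, and a half-open square keeps only
    the latter. Corners are excluded because the origins of several squares may be identified. *)
Lemma half_open_uniq i x j y : @same_point R SQ (i, x) (j, y) ->
  half_open x -> half_open y -> ~~ intp x -> i = j.
Proof.
move=> s hx hy nx.
case: (same_pointP (@square_glue R n h v) (@square_convex R n h v)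
  (@square_parallel_unique R n h v) s) => [[]//|[l k] t t01 [E1 E2] [E3 E4]|e f _ E _].
  move: hx hy; rewrite E2 E4 !square_edge_vec {s nx E1 E2 E3 E4}; case/andP: t01 => t0 t1.
  rewrite /half_open; elim/ord4_ind: k;
    rewrite !ordS_inord // /square_corner /square_side /= !inordK //=;
    move=> /andP[/andP[? ?] /andP[? ?]] /andP[/andP[? ?] /andP[? ?]]; exfalso; lra.
by case/negP: nx; have := square_vertex_int e; rewrite -E.
Qed.

Definition canonical_square (p : face SQ * (R * R)) i :=
  exists2 x, half_open x & same_point p (i, x).

(** Leads from a closed square to the half-open square that owns the point. At (1, 1), where the
    order of [h] and [v] would matter, the value is a mere default. *)
Definition side_perm x : {perm 'I_n} :=
  if x.1 == 1 then h else if x.2 == 1 then v else 1%g.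

Lemma canonical_side_perm i x : @region R SQ i x -> ~~ intp x ->
  canonical_square (i, x) (side_perm x i).
Proof.
move=> /square_region [x1 x2]; have xE : x = (x.1, x.2) by case: x {x1 x2}.
rewrite /side_perm /intp; have [e1|n1] := eqVneq x.1 1.
  rewrite e1 rpred1 /= => ni; exists (0, x.2); last first.
    by rewrite xE e1; apply: same_right.
  rewrite /half_open /= lexx ltr01 /=; case/andP: x2 => -> x2; rewrite lt_neqAle x2 andbT.
  by apply: contra ni => /eqP ->; rewrite rpred1.
case: (eqVneq x.2 1) => [e2|n2] ni.
  exists (x.1, 0); last by rewrite xE e2; apply: same_top.
  by rewrite /half_open /= lexx ltr01 andbT; case/andP: x1 => -> x1; rewrite lt_neqAle x1 n1.
exists x; last by rewrite perm1; apply: same_refl.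
by rewrite /half_open; case/andP: x1 => -> x1; case/andP: x2 => -> x2; rewrite !lt_neqAle x1 n1 x2 n2.
Qed.

Lemma canonical_square_uniq p i j : canonical_square p i -> canonical_square p j ->
  ~~ intp p.2 -> i = j.
Proof.
move=> [x hx sx] [y hy sy] np; apply: (half_open_uniq (x := x) (y := y)) => //.
  by apply: same_trans sy; apply: same_sym.
apply: contra np => ix; rewrite -(subrK x p.2) intpD //.
exact: (same_congr sx).
Qed.

(* A short path changes square in a way that depends only on the change of the
   integer parts of its coordinates, not on the starting square. *)
Definition step_perm (d : int * int) : {perm 'I_n} :=
  ((if (d.1 == -1)%R then h^-1 else if (d.2 == -1)%R then v^-1 else 1) *
   (if (d.1 == 1)%R then h else if (d.2 == 1)%R then v else 1))%g.

Definition pfloor x : int * int := (Num.floor x.1, Num.floor x.2).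

Lemma odd_step_perm d : odd_perm h = false -> odd_perm v = false ->
  odd_perm (step_perm d) = false.
Proof.
move=> h0 v0; rewrite odd_permM; do !case: ifP => _;
  by rewrite ?odd_permV ?h0 ?v0 ?odd_perm1.
Qed.

(** Away from corners at most one coordinate of each point is 1, so the difference of the floors
    tells which side is left by [x] and which is reached by [x']. *)
Lemma side_step_perm i x x' : @region R SQ i x -> ~~ intp x ->
  @region R SQ i x' -> ~~ intp x' ->
  side_perm x' i = step_perm (pfloor x' - pfloor x) (side_perm x i).
Proof.
move=> /square_region [x1 x2] nx /square_region [x1' x2'] nx'.
rewrite /pfloor !floor01 // /step_perm /side_perm /=.
move: nx nx'; rewrite /intp.
case: (eqVneq x.1 1) => [-> |n1]; case: (eqVneq x.2 1) => [->|n2];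
case: (eqVneq x'.1 1) => [-> |n1']; case: (eqVneq x'.2 1) => [->|n2'];
  rewrite ?rpred1 //= => _ _; by rewrite !permM ?permK ?perm1 ?permKV.
Qed.

End Squares.

(** * Generic points of the unit square *)

Section GenericPoint.
Variable R : realType.

(** For z = (e, e^2) with e small, [cross (V i) z] is less than 1 in absolute value, so an integer
    value is 0. Then [(V i).2] is e times [(V i).1], an integer less than 1 in absolute value, and
    both coordinates vanish. *)
Lemma generic_point (I : finType) (V : I -> R * R) :
  (forall i, intp (V i)) -> (forall i, V i != 0) ->
  exists z : R * R, [/\ 0 < z.1 < 1, 0 < z.2 < 1
    & forall i, cross (V i) z \isn't a Num.int].
Proof.
move=> intV V0; pose M := \sum_i (`|(V i).1| + `|(V i).2|).
have leM i : `|(V i).1| + `|(V i).2| <= M.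
  by rewrite /M (bigD1 i) //= lerDl sumr_ge0 // => j _; rewrite addr_ge0.
have M0 : 0 <= M by rewrite sumr_ge0 // => j _; rewrite addr_ge0.
have d0 : 0 < 2 + M by lra.
pose e := (2 + M)^-1; have e0 : 0 < e by rewrite invr_gt0.
have eE : e * (2 + M) = 1 by rewrite mulVf // gt_eqF.
have eM : 0 <= e * M by rewrite mulr_ge0 // ltW.
have e1 : e < 1 by lra.
have ee : e * e < e by rewrite gtr_pMl.
exists (e, e * e); rewrite /= e0 e1 mulr_gt0 // (lt_trans ee e1); split => // i.
apply/negP => /int_small; rewrite /cross /=.
have n1 := normr_ge0 (V i).1; have n2 := normr_ge0 (V i).2.
have le1 : `|(V i).1| * e <= M * e by rewrite ler_pM2r //; have := leM i; lra.
have le2 : `|(V i).2| * e <= M * e by rewrite ler_pM2r //; have := leM i; lra.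
have b : `|(V i).1 * e - (V i).2| < e^-1.
  rewrite invrK; apply: le_lt_trans (ler_normB _ _) _.
  rewrite normrM (gtr0_norm e0); have := leM i; lra.
have E : (V i).1 * (e * e) - (V i).2 * e = e * ((V i).1 * e - (V i).2) by ring.
have lt1 : -1 < (V i).1 * (e * e) - (V i).2 * e < 1.
  by rewrite -ltr_norml E normrM (gtr0_norm e0) -ltr_pdivlMl // mulr1.
move=> /(_ lt1); rewrite E => /eqP; rewrite mulf_eq0 (gt_eqF e0) /= subr_eq0 => /eqP V2.
have /andP[_ i2] := intV i.
have v2 : (V i).2 = 0.
  apply: int_small => //; rewrite -ltr_norml -V2 normrM (gtr0_norm e0); lra.
have v1 : (V i).1 = 0.
  by move: V2; rewrite v2 => /eqP; rewrite mulf_eq0 (gt_eqF e0) orbF => /eqP.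
by case/negP: (V0 i); apply/eqP/pair_ext.
Qed.
End GenericPoint.

(** * Lattice points of P and the squares over its other points *)

Section Presentation.
Variable R : realType.
Variable P : gluing R.
Variable n : nat.
Variables h v : {perm 'I_n}.
Notation SQ := (square_tiled R h v).
Variable rel : face P * (R * R) -> face SQ * (R * R) -> Prop.
Hypothesis cr : correspondence rel.
Hypothesis cr' : @correspondence R SQ P (fun p q => rel q p).
Variable B : face P.
Hypothesis oneB : forall A : face P, A = B.
Hypothesis convP : convex_polygons P.
Implicit Types (x y u w : R * R) (i j : 'I_n).

Lemma region_inhabited : exists y, region B y.
Proof.
have [_ _ /(_ B) [e eB] _ _] := convP.
exists (start e) => f fB; apply: region_start => //; by rewrite eB fB.
Qed.

Lemma rel_same y q q' : rel (B, y) q -> rel (B, y) q' -> same_point q q'.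
Proof. by move=> r1 r2; apply/(corr_same cr r1 r2); apply: same_refl. Qed.

(** The displacement between corresponding points is constant modulo Z^2 along short segments, hence
    on all of P by continuation from [y0]. It makes the lattice points of P well defined. *)
Lemma lattice_offset_exists : exists c0 : R * R,
  forall y i x, rel (B, y) (i, x) -> intp (x - y - c0).
Proof.
have [y0 ry0] := region_inhabited.
have [[i0 x0] r0] := corr_total cr ry0.
exists (x0 - y0) => y i x r.
have ry : region B y by case: (corr_region cr r).
pose Q t := forall i x, rel (B, y0 + scale t (y - y0)) (i, x) ->
  intp (x - (y0 + scale t (y - y0)) - (x0 - y0)).
have yE : y0 + scale 1 (y - y0) = y by apply: pair_ext; rewrite !coordE; ring.
suff Q1 : Q 1 by have := Q1 i x; rewrite yE; apply.
apply: (@unit_interval_ind R Q) => [t t01|j x' r'].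
  set yt := y0 + scale t (y - y0).
  have ryt : region B yt by exact: region_conv.
  have [e e0 He] := corr_local cr ryt.
  have [t1 t1_gt0 Ht1] := small_scale (y - y0) e0.
  exists t1 => // t' t01' tt'; rewrite /Q; set yt' := y0 + scale t' _.
  have ryt' : region B yt' by exact: region_conv.
  have nyt : near e yt yt'.
    have [|k1 k2] := Ht1 `|t' - t|; first by rewrite normr_ge0 ltW.
    rewrite /near.
    have -> : yt'.1 - yt.1 = (t' - t) * (y - y0).1 by rewrite !coordE; ring.
    have -> : yt'.2 - yt.2 = (t' - t) * (y - y0).2 by rewrite !coordE; ring.
    by move: k1 k2; rewrite !normrM !normr_id.
  have [C [c Hc]] := He _ ryt' nyt.
  have ra : rel (B, yt) (C, yt + c).
    have := Hc 0; rewrite lexx ler01 => /(_ isT).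
    by have -> : yt + scale 0 (yt' - yt) = yt by apply: pair_ext; rewrite !coordE; ring.
  have rb : rel (B, yt') (C, yt' + c).
    have := Hc 1; rewrite lexx ler01 => /(_ isT).
    by have -> : yt + scale 1 (yt' - yt) = yt' by apply: pair_ext; rewrite !coordE; ring.
  have key z z' : rel (B, z) (C, z + c) -> rel (B, z') (C, z' + c) ->
    (forall i x, rel (B, z) (i, x) -> intp (x - z - (x0 - y0))) ->
    forall i x, rel (B, z') (i, x) -> intp (x - z' - (x0 - y0)).
    move=> rz rz' Hz k x' rk; have := same_congr (rel_same rk rz'); have := Hz _ _ rz => /=.
    move=> i1 i2; have := intpD i1 i2; congr intp.
    by apply: pair_ext; rewrite !coordE; ring.
  by split; apply: key.
have y0E : y0 + scale 0 (y - y0) = y0 by apply: pair_ext; rewrite !coordE; ring.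
rewrite y0E in r' *; have := same_congr (rel_same r' r0); congr intp.
by apply: pair_ext; rewrite !coordE; ring.
Qed.

Variable c0 : R * R.
Hypothesis offset : forall y i x, rel (B, y) (i, x) -> intp (x - y - c0).

Definition lattice y := intp (y + c0).

Lemma rel_lattice y i x : rel (B, y) (i, x) -> lattice y = intp x.
Proof.
move=> /offset io; apply/idP/idP => [ly|ix].
  have := intpD io ly; congr intp; apply: pair_ext; rewrite !coordE; ring.
have := intpB ix io; congr intp; apply: pair_ext; rewrite !coordE; ring.
Qed.

Definition over y i := exists2 q, rel (B, y) q & canonical_square q i.

Lemma over_exists y : region B y -> ~~ lattice y -> exists i, over y i.
Proof.
move=> ry ny; have [[i x] r] := corr_total cr ry.
exists (side_perm h v x i), (i, x) => //; apply: canonical_side_perm.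
  by case: (corr_region cr r).
by rewrite -(rel_lattice r).
Qed.

Lemma over_uniq y i j : ~~ lattice y -> over y i -> over y j -> i = j.
Proof.
move=> ny [[k x] r c] [[k' x'] r' [x'' hx sx]].
apply: (canonical_square_uniq c (j := j)); last by rewrite /= -(rel_lattice r).
by exists x'' => //; apply: same_trans sx; apply: (rel_same r r').
Qed.

(** One translation carries [y] and [y'] into the same closed square. It differs from [c0] by an
    integer vector, which cancels in the difference of the floors, so the permutation depends on
    positions in P only. *)
Lemma over_step y : region B y -> ~~ lattice y ->
  exists2 e, 0 < e & forall y', region B y' -> ~~ lattice y' -> near e y y' ->
    forall i j, over y i -> over y' j ->
      j = step_perm h v (pfloor (y' + c0) - pfloor (y + c0)) i.
Proof.
move=> ry ny; have [e e0 He] := corr_local cr ry.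
exists e => // y' ry' ny' nyy' i j oi oj.
have [C [c Hc]] := He _ ry' nyy'.
have ra : rel (B, y) (C, y + c).
  have := Hc 0; rewrite lexx ler01 => /(_ isT).
  by have -> : y + scale 0 (y' - y) = y by apply: pair_ext; rewrite !coordE; ring.
have rb : rel (B, y') (C, y' + c).
  have := Hc 1; rewrite lexx ler01 => /(_ isT).
  by have -> : y + scale 1 (y' - y) = y' by apply: pair_ext; rewrite !coordE; ring.
have nx : ~~ intp (y + c) by rewrite -(rel_lattice ra).
have nx' : ~~ intp (y' + c) by rewrite -(rel_lattice rb).
have [_ rx] := corr_region cr ra; have [_ rx'] := corr_region cr rb.
have -> : i = side_perm h v (y + c) C.
  apply: (over_uniq ny oi); exists (C, y + c) => //; exact: canonical_side_perm.
have -> : j = side_perm h v (y' + c) C.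
  apply: (over_uniq ny' oj); exists (C, y' + c) => //; exact: canonical_side_perm.
rewrite (side_step_perm rx nx rx' nx'); congr (step_perm _ _ _ _).
have /andP[i1 i2] := offset ra.
have pf z : pfloor (z + c) = pfloor (z + c0) + pfloor (y + c - y - c0).
  rewrite /pfloor; congr pair.
    by rewrite -[in RHS]floorDrz //; congr Num.floor; rewrite !coordE; ring.
  by rewrite -[in RHS]floorDrz //; congr Num.floor; rewrite !coordE; ring.
by rewrite !pf opprD addrACA subrr addr0.
Qed.

Lemma over_square y i x : rel (B, y) (i, x) -> half_open x -> over y i.
Proof. by move=> r hx; exists (i, x) => //; exists x => //; apply: same_refl. Qed.

Lemma near_translate e x u t t' : 
  `|(t' - t) * u.1| < e -> `|(t' - t) * u.2| < e -> near e (x + scale t u) (x + scale t' u).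
Proof.
have E (a b : R) : a + t' * b - (a + t * b) = (t' - t) * b by ring.
by rewrite /near !coordE !E.
Qed.

(* Following the direction [w] inside the strip permutes the squares by a fixed
   even permutation [g]; as the region meets a coset in all the squares, [g] is
   an [n]-cycle. *)
Lemma strip_absurd w w' a : odd_perm h = false -> odd_perm v = false ->
  (0 < n)%N -> ~~ odd n ->
  intp w -> intp w' -> cross w w' = 1 -> lattice a ->
  (forall y, region B y -> 0 <= cross w (y - a) <= 1) -> False.
Proof.
move=> h0 v0 n0 evn iw iw' ww' la strip.
have w0 : w != 0.
  apply/eqP => E; move: ww'; rewrite E /cross !mul0r subrr => /eqP.
  by rewrite eq_sym oner_eq0.
(* A line in direction [w] through this coset meets no lattice point, so the path followed below
   avoids corners. *)
have [z [z1 z2 /(_ tt) nz]] := @generic_point R unit (fun _ => w) (fun _ => iw) (fun _ => w0).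
have hz : half_open z.
  by rewrite /half_open; case/andP: z1 => /ltW -> ->; case/andP: z2 => /ltW -> ->.
have /choice [Y HY] : forall i, exists y, rel (B, y) (i, z).
  move=> i; have rz : @region R SQ i z.
    by apply/square_region; case/andP: z1 => /ltW -> /ltW ->; case/andP: z2 => /ltW -> /ltW ->.
  by have [[B' y]] := corr_total cr' rz; rewrite (oneB B'); exists y.
have rY i : region B (Y i) by case: (corr_region cr (HY i)).
have oY i : over (Y i) i := over_square (HY i) hz.
have congY i j : intp (Y i - Y j).
  have := intpB (offset (HY j)) (offset (HY i)); congr intp.
  by apply: pair_ext; rewrite !coordE; ring.
have levY i : 0 < cross w (Y i - a) < 1.
  have ni : cross w (Y i - a) \isn't a Num.int.
    apply: contra nz => ic.
    have iz : intp (z - (Y i - a)).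
      have := intpD (offset (HY i)) la; congr intp.
      by apply: pair_ext; rewrite !coordE; ring.
    have -> : cross w z = cross w (Y i - a) + cross w (z - (Y i - a)).
      by rewrite /cross !coordE; ring.
    by rewrite rpredD // intp_cross.
  have /andP[a0 a1] := strip _ (rY i).
  rewrite !lt_def a0 a1 !andbT; apply/andP; split; apply: contra ni => /eqP.
    by move=> ->; rewrite rpred0.
  by move=> <-; rewrite rpred1.
(* Levels of points of one coset differ by integers; lying strictly between 0 and 1 they are equal,
   so all the points [Y i] are on one line. *)
have paraY i j : Y i = Y j + scale (cross (Y i - Y j) w') w.
  have c0' : cross w (Y i - Y j) = 0.
    apply: int_small; first exact: intp_cross.
    have -> : cross w (Y i - Y j) = cross w (Y i - a) - cross w (Y j - a).
      by rewrite /cross !coordE; ring.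
    by have /andP[? ?] := levY i; have /andP[? ?] := levY j; apply/andP; split; lra.
  have nz' : cross w w' != 0 by rewrite ww' oner_eq0.
  have := cross_basis (Y i - Y j) nz'; rewrite ww' c0' !divr1; set c := cross _ w' => E.
  by rewrite -[LHS](subrK (Y j)) E addrC; congr (_ + _); apply: pair_ext; rewrite !coordE; ring.
pose lvl i := cross (Y i) w'.
have [i0 _ min0] := @Order.TotalTheory.arg_minP _ R 'I_n (Ordinal n0) xpredT lvl isT.
have [i1 _ max1] := @Order.TotalTheory.arg_maxP _ R 'I_n (Ordinal n0) xpredT lvl isT.
have /choice [K HK] : forall i, exists k : nat, cross (Y i - Y i0) w' = k%:R.
  move=> i; apply/natrP; rewrite natrEint intp_cross //=.
  have m0 : lvl i0 <= lvl i := min0 i isT.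
  by move: m0; rewrite /lvl /cross !coordE; lra.
pose J := K i1.
have KJ i : (K i <= J)%N.
  have m1 : lvl i <= lvl i1 := max1 i isT.
  by rewrite -(ler_nat R) -!HK; move: m1; rewrite /lvl /cross !coordE; lra.
have YK i : Y i = Y i0 + scale (K i)%:R w by rewrite {1}(paraY i i0) HK.
pose y t := Y i0 + scale t w.
have ry t : 0 <= t <= J%:R -> region B (y t).
  move=> /andP[t0 tJ]; have [J0|J0] := posnP J.
    have -> : y t = Y i0; last exact: rY.
    have -> : t = 0 by apply/eqP; rewrite eq_le t0 andbT; move: tJ; rewrite J0.
    by rewrite /y; apply: pair_ext; rewrite !coordE; ring.
  have J0' : 0 < J%:R :> R by rewrite ltr0n.
  have -> : y t = Y i0 + scale (t / J%:R) (Y i1 - Y i0).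
    by rewrite (YK i1) -/J /y; apply: pair_ext; rewrite !coordE; field; rewrite gt_eqF.
  by apply: region_conv => //; rewrite divr_ge0 ?(ltW J0') //= ler_pdivrMr // mul1r.
have ny t : ~~ lattice (y t).
  apply: contra nz => ly; have ic := offset (HY i0).
  have -> : cross w z = cross w (y t + c0) + cross w (z - Y i0 - c0).
    by rewrite /y /cross !coordE; ring.
  by rewrite rpredD // intp_cross.
have natw k : intp (scale k%:R w).
  by case/andP: iw => u1 u2; rewrite /intp !coordE !rpredM ?natr_int.
have pf (t : R) (k : nat) :
    pfloor (y (k%:R + t) + c0) = pfloor (y t + c0) + pfloor (scale k%:R w).
  rewrite /pfloor; have /andP[u1 u2] := natw k.
  by congr pair; rewrite -[in RHS]floorDrz //; congr Num.floor; rewrite /y !coordE; ring.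
have inJ (k : 'I_J) (t : R) : 0 <= t <= 1 -> 0 <= k%:R + t <= J%:R.
  move=> /andP[t0 t1]; rewrite addr_ge0 //=.
  by apply: (@le_trans _ _ (k.+1)%:R); rewrite ?ler_nat // -addn1 natrD lerD2l.
(* The points [y (k%:R + t)] differ from each other by integer vectors, so they cross sides of
   squares at the same times and in the same way: one permutation serves all [k]. *)
pose Q t := exists2 g : {perm 'I_n}, odd_perm g = false & forall (k : 'I_J) i j,
  over (y k%:R) i -> over (y (k%:R + t)) j -> j = g i.
have [g evg Hg] : Q 1.
  apply: (@unit_interval_ind R Q) => [t t01|]; last first.
    exists 1%g; rewrite ?odd_perm1 // => k i j; rewrite addr0 perm1 => oi oj.
    by apply: (over_uniq (y := y k%:R)).
  have [||e e0 He] := @finite_eps R 'I_J (fun k e => forall y',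
      region B y' -> ~~ lattice y' -> near e (y (k%:R + t)) y' -> forall i j,
      over (y (k%:R + t)) i -> over y' j ->
      j = step_perm h v (pfloor (y' + c0) - pfloor (y (k%:R + t) + c0)) i).
  - move=> k e e' _ ee' H y' ry' ny' [u1 u2]; apply: H => //.
    by split; [apply: lt_le_trans u1 _|apply: lt_le_trans u2 _].
  - by move=> k; apply: over_step => //; apply/ry/inJ.
  have [t1 t1_gt0 Ht1] := small_scale w e0.
  exists t1 => // t' t01' tt'.
  pose d := pfloor (y t' + c0) - pfloor (y t + c0).
  have step (k : 'I_J) i j : over (y (k%:R + t)) i -> over (y (k%:R + t')) j ->
      j = step_perm h v d i.
    move=> oi oj; have -> : d = pfloor (y (k%:R + t') + c0) - pfloor (y (k%:R + t) + c0).
      by rewrite !pf opprD addrACA subrr addr0.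
    apply: (He k) => //; first exact/ry/inJ.
    have [|k1 k2] := Ht1 `|t' - t|; first by rewrite normr_ge0 ltW.
    have dt : k%:R + t' - (k%:R + t) = t' - t by ring.
    by apply: near_translate; rewrite dt; [move: k1|move: k2]; rewrite !normrM normr_id.
  have evd := odd_step_perm d h0 v0.
  split=> -[g evg Hg].
    exists (g * step_perm h v d)%g; first by rewrite odd_permM evg evd.
    move=> k i j oi oj; have [i' oi'] := over_exists (ry _ (inJ k t t01)) (ny _).
    by rewrite permM -(Hg k i i') //; apply: (step k).
  exists (g * (step_perm h v d)^-1)%g; first by rewrite odd_permM odd_permV evg evd.
  move=> k i j oi oj; have [i' oi'] := over_exists (ry _ (inJ k t' t01')) (ny _).
  by rewrite permM -(Hg k i i') // (step k j i') // permK.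
have orb k : (k <= J)%N -> over (y k%:R) ((g ^+ k)%g i0).
  elim: k => [|k IH] kJ.
    by rewrite expg0 perm1 /y; have -> : Y i0 + scale 0%:R w = Y i0
      by apply: pair_ext; rewrite !coordE; ring.
  have [j oj] : exists j, over (y k.+1%:R) j.
    by apply: over_exists; [apply: ry; rewrite ler0n ler_nat | apply: ny].
  rewrite expgSr permM -(Hg (Ordinal kJ) _ j (IH (ltnW kJ))) //.
  by rewrite /= -[in k%:R + 1](natrD _ k 1) addn1.
have all i : i = (g ^+ K i)%g i0.
  apply: (over_uniq (y := Y i)) (oY i) _; first by have := ny (K i)%:R; rewrite /y -YK.
  by have := orb _ (KJ i); rewrite /y -YK.
(* The parity of a permutation is that of n plus the number of its orbits; with a single orbit and n
   even, [g] would be odd. *)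
have : odd_perm g = odd n (+) odd #|porbits g| by rewrite /odd_perm card_ord.
have -> : porbits g = [set [set: 'I_n]]%SET.
  apply/setP => X; rewrite inE; apply/imsetP/eqP => [[i _ ->]|->]; last first.
    by exists i0 => //; apply/setP => i; rewrite inE [i]all mem_porbit.
  by apply/setP => j; rewrite inE (all i) porbit_perm (all j) mem_porbit.
by rewrite cards1 evg (negbTE evn).
Qed.

End Presentation.

(** * Sides of a polygon that may consist of several edges *)

Section SideWidth.
Variable R : realType.
Variable P : gluing R.
Variable B : face P.
Hypothesis oneB : forall A : face P, A = B.
Hypothesis convP : convex_polygons P.
Implicit Types (e f : edge P) (x y w : R * R).

Lemma same_face e f : face_of e = face_of f.
Proof. by rewrite (oneB (face_of e)) (oneB (face_of f)). Qed.

Lemma region_vertex e : region B (start e).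
Proof. by move=> f _; apply: (region_start convP); apply: same_face. Qed.

Lemma not_interior_side y : region B y -> ~ interior B y ->
  exists e, side e y = 0.
Proof.
move=> ry /existsNP [e /not_implyP [eB /negP]]; rewrite -leNgt => le0.
by exists e; apply/eqP; rewrite eq_le le0 /=; apply: ry.
Qed.

(** For nonzero [w], the edges that together form the side of the polygon in direction [w]. *)
Definition codirected w e := (cross w (edge_vec e) == 0) && (0 < dot w (edge_vec e)).

Lemma dotDr w x y : dot w (x + y) = dot w x + dot w y.
Proof. by rewrite /dot !coordE; ring. Qed.
Lemma dotBr w x y : dot w (x - y) = dot w x - dot w y.
Proof. by rewrite /dot !coordE; ring. Qed.
Lemma dotZr w t x : dot w (scale t x) = t * dot w x.
Proof. by rewrite /dot !coordE; ring. Qed.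

Lemma codirectedE w e : w != 0 -> codirected w e ->
  exists2 r, 0 < r & edge_vec e = scale r w.
Proof.
move=> w0 /andP[/eqP c0 d0]; exists (dot w (edge_vec e) / dot w w).
  by rewrite divr_gt0 // dot_gt0.
exact: cross0_scale.
Qed.

(* Every vertex on the line of [e0] is the start of one edge and the end of one
   edge.  Comparing the two sums of [F] over these vertices, everything cancels
   except the edges leaving or reaching the line. *)
Lemma side_width w e0 : w != 0 -> codirected w e0 ->
  exists yL yR, [/\ region B yL, region B yR, cross w (yL - start e0) = 0,
    yR = yL + scale ((\sum_(e | codirected w e) dot w (edge_vec e)) / dot w w) w
  & forall a, region B a -> cross w (a - start e0) = 0 ->
      dot w yL <= dot w a <= dot w yR].
Proof.
move=> w0 c0; have dw := dot_gt0 w0; have [r0 r0_gt0 e0E] := codirectedE w0 c0.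
pose lev y := cross w (y - start e0).
have lev_ge0 y : region B y -> 0 <= lev y.
  by move=> /(_ e0 (oneB _)); rewrite e0E crossZl pmulr_rge0.
have lev_end e : lev (start (nxt e)) = lev (start e) + cross w (edge_vec e).
  by rewrite /lev end_startE /cross !coordE; ring.
have cod_lev e : codirected w e -> lev (start e) = 0.
  move=> /(codirectedE w0) [r r_gt0 eE]; apply/eqP; rewrite eq_le lev_ge0 ?andbT; last exact: region_vertex.
  have := region_vertex e0 (oneB (face_of e)); rewrite eE crossZl pmulr_rge0 // /lev.
  by rewrite -(opprB (start e)) crossNr oppr_ge0.
pose on e := lev (start e) == 0.
pose up e := on e && (0 < cross w (edge_vec e)).
pose down e := on (nxt e) && (cross w (edge_vec e) < 0).
have cod_on e : lev (start e) = 0 -> cross w (edge_vec e) = 0 -> codirected w e.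
  move=> l0 ce; rewrite /codirected ce eqxx /=.
  have [|//|r r_gt0 ->] := @collinear_edges _ _ convP e0 e (same_face _ _).
  - by rewrite /side e0E crossZl -/(lev _) l0 mulr0.
  - by rewrite e0E crossZl ce mulr0.
  - by rewrite e0E !dotZr !mulr_gt0.
have onE e : on e = codirected w e || up e.
  apply/idP/orP => [oe|[/cod_lev l0|/andP[]//]]; last by rewrite /on l0.
  have := lev_ge0 _ (region_vertex (nxt e)); rewrite lev_end (eqP oe) add0r.
  rewrite le_eqVlt => /orP[/eqP ce|ce]; last by right; rewrite /up oe.
  by left; apply: cod_on; rewrite ?(eqP oe).
have onE' e : on (nxt e) = codirected w e || down e.
  apply/idP/orP => [oe|[ce|/andP[]//]]; last first.
    by rewrite /on lev_end cod_lev // add0r; case/andP: ce.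
  have := lev_ge0 _ (region_vertex e).
  have -> : lev (start e) = - cross w (edge_vec e).
    by move: (oe); rewrite /on lev_end addr_eq0 => /eqP.
  rewrite oppr_ge0 le_eqVlt => /orP[/eqP ce|ce]; last by right; rewrite /down oe.
  by left; apply: cod_on => //; move: (oe); rewrite /on lev_end ce addr0 => /eqP.
have disU e : codirected w e -> up e = false.
  by move=> /andP[/eqP ce _]; rewrite /up ce ltxx andbF.
have disD e : codirected w e -> down e = false.
  by move=> /andP[/eqP ce _]; rewrite /down ce ltxx andbF.
have balance (F : R * R -> R) :
    \sum_(e | codirected w e) (F (start (nxt e)) - F (start e)) =
    \sum_(e | up e) F (start e) - \sum_(e | down e) F (start (nxt e)).
  have : \sum_(e | on e) F (start e) = \sum_(e | on (nxt e)) F (start (nxt e)).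
    exact: (reindex_inj (nxt_inj convP)).
  rewrite (bigID (codirected w)) /= [RHS](bigID (codirected w)) /=.
  have E1 (G : edge P -> R) (q c p : pred (edge P)) : (forall e, q e = c e || p e) ->
      (forall e, c e -> p e = false) ->
      \sum_(e | q e && c e) G e = \sum_(e | c e) G e /\
      \sum_(e | q e && ~~ c e) G e = \sum_(e | p e) G e.
    move=> qE dis; split; apply: eq_bigl => e; rewrite qE; move: (dis e); case: (c e); case: (p e) => //=.
    by move=> /(_ isT).
  have [-> ->] := E1 (fun e => F (start e)) _ _ _ onE disU.
  have [-> ->] := E1 (fun e => F (start (nxt e))) _ _ _ onE' disD.
  by rewrite sumrB; lra.
have on_line e a : on e -> lev a = 0 ->
    a - start e = scale (dot w (a - start e) / dot w w) w.
  move=> /eqP oe la; apply: cross0_scale w0 _.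
  by move: oe la; rewrite /lev /cross !coordE; lra.
have right_most e a : up e -> region B a -> lev a = 0 -> dot w a <= dot w (start e).
  move=> /andP[oe ce] ra la; have := ra e (oneB _).
  rewrite (on_line e a oe la) crossZr crossC mulrN.
  rewrite oppr_ge0 pmulr_lle0 // pmulr_lle0 ?invr_gt0 // dotBr; lra.
have left_most e a : down e -> region B a -> lev a = 0 -> dot w (start (nxt e)) <= dot w a.
  move=> /andP[oe ce] ra la; have := ra e (oneB _).
  have -> : a - start e = a - start (nxt e) + edge_vec e.
    by rewrite end_startE; apply: pair_ext; rewrite !coordE; ring.
  rewrite crossDr (on_line _ a oe la) crossuu addr0 crossZr crossC mulrN.
  rewrite oppr_ge0 nmulr_lle0 // pmulr_lge0 ?invr_gt0 // dotBr; lra.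
(* With F = 1 the balance says that the line is left as often as it is reached. An edge leaving it
   starts at the last point of P on the line, so there is only one, and likewise for an edge
   reaching it. *)
have count : \sum_(e | up e) (1 : R) = \sum_(e | down e) 1.
  have := balance (fun=> 1); rewrite big1 => [|e _]; last by rewrite subrr.
  by move=> /esym/eqP; rewrite subr_eq0 => /eqP.
have len e : dot w (start (nxt e)) - dot w (start e) = dot w (edge_vec e).
  by rewrite -dotBr.
have total : \sum_(e | codirected w e) dot w (edge_vec e) =
    \sum_(e | up e) dot w (start e) - \sum_(e | down e) dot w (start (nxt e)).
  by rewrite -balance; apply: eq_bigr => e _; rewrite len.
have total_gt0 : 0 < \sum_(e | codirected w e) dot w (edge_vec e).
  rewrite (bigD1 e0) //= ltr_wpDr //; last by case/andP: c0.
  by apply: sumr_ge0 => e /andP[/andP[_ /ltW]].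
have eq_start e e' : on e -> on e' -> dot w (start e) = dot w (start e') -> e = e'.
  move=> oe oe' de; apply: (start_inj convP); first exact: same_face.
  apply/eqP; rewrite -subr_eq0 (on_line e' (start e)) //; last exact/eqP.
  by rewrite dotBr de subrr !mul0r; apply/eqP/pair_ext; rewrite !coordE; ring.
case: (pickP up) => [eU upU|noU]; last first.
  have noD : down =1 pred0.
    move=> e; apply/negP => de; move: count; rewrite (eq_bigl _ _ noU) big_pred0_eq.
    rewrite (bigD1 e) //= => /eqP; rewrite eq_sym paddr_eq0 ?oner_eq0 //.
    by apply: sumr_ge0.
  by move: total_gt0; rewrite total (eq_bigl _ _ noU) (eq_bigl _ _ noD) !big_pred0_eq subrr ltxx.
have oU : on eU by case/andP: upU.
have upE : up =1 pred1 eU.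
  move=> e; apply/idP/eqP => [ue|->//]; have oe : on e by case/andP: ue.
  apply: eq_start => //; apply/eqP; rewrite eq_le !right_most //; try exact: region_vertex.
    exact/eqP.
  exact/eqP.
case: (pickP down) => [eD downD|noD]; last first.
  move: count; rewrite (eq_bigl _ _ noD) (eq_bigl _ _ upE) big_pred0_eq big_pred1_eq.
  by move=> /eqP; rewrite oner_eq0.
have oD : on (nxt eD) by case/andP: downD.
have downE : down =1 pred1 eD.
  move=> e; apply/idP/eqP => [de|->//]; have oe : on (nxt e) by case/andP: de.
  apply: (nxt_inj convP); apply: eq_start => //; apply/eqP; rewrite eq_le !left_most //;
    try exact: region_vertex; exact/eqP.
move: total; rewrite (eq_bigl _ _ upE) (eq_bigl _ _ downE) !big_pred1_eq => total.
exists (start (nxt eD)), (start eU); split; try exact: region_vertex.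
- exact/eqP.
- by rewrite total -dotBr -(on_line _ _ oD) 1?addrC ?subrK //; exact/eqP.
- by move=> a ra la; rewrite left_most // right_most.
Qed.

Hypothesis glP : translation_gluing P.

Lemma codirected_glue w e : codirected (- w) (glue e) = codirected w e.
Proof.
rewrite /codirected (edge_vec_glue glP) crossNl crossNr opprK; congr (_ && (_ < _)).
by rewrite /dot !coordE; ring.
Qed.

(** [glue] exchanges the edges in the directions [w] and [- w] and keeps their lengths, so opposite
    sides are equally long however their edges are permuted. *)
Lemma opposite_width w : (\sum_(e | codirected (- w) e) dot (- w) (edge_vec e)) / dot (- w) (- w) =
  (\sum_(e | codirected w e) dot w (edge_vec e)) / dot w w.
Proof.
have dN x y : dot (- x) (- y) = dot x y by rewrite /dot !coordE; ring.
rewrite dN (reindex_inj (can_inj (glueK glP))) /=; congr (_ / _).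
by apply: eq_big => [e|e _]; rewrite ?codirected_glue // (edge_vec_glue glP) dN.
Qed.

(** The slope exceeds those of all edges that are not vertical, so the direction is transversal to
    every edge. Being positive, it points into a unit square from its lower left corner. *)
Lemma generic_slope : exists2 s, 0 < s & forall e : edge P, cross (edge_vec e) (1, s) != 0.
Proof.
exists (1 + \sum_(e : edge P) `|(edge_vec e).2 / (edge_vec e).1|).
  by rewrite ltr_wpDr // sumr_ge0.
move=> e; set s := 1 + _.
have -> : cross (edge_vec e) (1, s) = (edge_vec e).1 * s - (edge_vec e).2.
  by rewrite /cross mulr1.
have [v1|v1] := eqVneq (edge_vec e).1 0.
  rewrite v1 mul0r add0r oppr_eq0; apply/eqP => v2.
  by have /eqP := edge_vec_neq0 convP e; apply; apply: pair_ext.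
rewrite subr_eq0; apply/eqP => E.
have sE : s = (edge_vec e).2 / (edge_vec e).1 by rewrite -E mulrAC divff // mul1r.
have : `|(edge_vec e).2 / (edge_vec e).1| < s.
  rewrite /s (bigD1 e) //=; have : 0 <= \sum_(i | i != e) `|(edge_vec i).2 / (edge_vec i).1|.
    exact: sumr_ge0.
  lra.
by rewrite -sE; have := ler_norm s; lra.
Qed.

End SideWidth.

(** * Rays that enter a square at a corner *)

Section Rays.
Variable R : realType.
Variable P : gluing R.
Variable n : nat.
Variables h v : {perm 'I_n}.
Notation SQ := (square_tiled R h v).
Variable rel : face P * (R * R) -> face SQ * (R * R) -> Prop.
Hypothesis cr : correspondence rel.
Hypothesis cr' : @correspondence R SQ P (fun p q => rel q p).
Variable B : face P.
Hypothesis oneB : forall A : face P, A = B.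
Implicit Types (x y u w : R * R) (i j : 'I_n).

Definition ray_over i x u y (t1 : R) :=
  0 < t1 /\ forall t, 0 <= t <= t1 -> rel (B, y + scale t u) (i, x + scale t u).

Lemma ray_over_exists i x u t0 : @region R SQ i x -> 0 < t0 ->
  (forall t, 0 < t <= t0 -> @interior R SQ i (x + scale t u)) ->
  exists y t1, t1 <= t0 /\ ray_over i x u y t1.
Proof.
move=> rx t0_gt0 it; have ru : @region R SQ i (x + scale t0 u).
  by apply: interior_region; apply: it; rewrite t0_gt0 lexx.
have [t1 /andP[t1_gt0 t10] [A [y Hy]]] := corr_ray cr' rx t0_gt0 ru.
by exists y, t1; split => //; split => // t /Hy; rewrite (oneB A).
Qed.

Lemma scale0 u : scale 0 u = 0.
Proof. by apply: pair_ext; rewrite !coordE mul0r. Qed.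

Lemma ray_over_start i x u y t1 : ray_over i x u y t1 -> rel (B, y) (i, x).
Proof.
by case=> t0 /(_ 0); rewrite lexx (ltW t0) !scale0 !addr0; apply.
Qed.

Lemma ray_over_region i x u y t1 : ray_over i x u y t1 ->
  region B y /\ region B (y + scale t1 u).
Proof.
move=> r; split; first by case: (corr_region cr (ray_over_start r)).
by case: r => t0 /(_ t1); rewrite lexx (ltW t0) => /(_ isT) /(corr_region cr)[].
Qed.

(** Germs that agree in P would agree in S, but one of them runs in the interior of square [i] and
    the other one in square [j]. This is the substitute for measuring cone angles. *)
Lemma rays_over_neq i j x u y y' t0 t1 t2 : i != j ->
  (forall t, 0 < t <= t0 -> @interior R SQ i (x + scale t u)) ->
  t1 <= t0 -> ray_over i x u y t1 -> ray_over j x u y' t2 ->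
  (exists2 t3, 0 < t3 & forall t, 0 <= t <= t3 ->
    same_point (B, y + scale t u) (B, y' + scale t u)) -> False.
Proof.
move=> ij it t10 [t1_gt0 H1] [t2_gt0 H2] [t3 t3_gt0 H3].
pose t := Num.min t1 (Num.min t2 t3).
have t_gt0 : 0 < t by rewrite !lt_min t1_gt0 t2_gt0.
have le1 : t <= t1 by rewrite ge_min lexx.
have le2 : t <= t2 by rewrite !ge_min lexx !orbT.
have le3 : t <= t3 by rewrite !ge_min lexx !orbT.
have r1 := H1 t; have r2 := H2 t; have s3 := H3 t; move: r1 r2 s3.
rewrite (ltW t_gt0) le1 le2 le3 => /(_ isT) r1 /(_ isT) r2 /(_ isT) s3.
have /(corr_same cr r1 r2) := s3.
have : @interior R SQ i (x + scale t u) by apply: it; rewrite t_gt0 (le_trans le1).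
move=> int_i /(same_interior (@square_glue R n h v) int_i) /(congr1 fst) /= E.
by rewrite E eqxx in ij.
Qed.

(** The bound makes [t * (1 + s)] less than 1, which keeps both coordinates inside the square. *)
Lemma corner_ray i s : 0 < s -> forall t, 0 < t <= (1 + s)^-1 / 2 ->
  @interior R SQ i (0 + scale t (1, s)) /\
  @interior R SQ i ((1, 1) + scale t (- (1, s))).
Proof.
move=> s0 t /andP[t0 t1]; have d : 0 < 1 + s by lra.
have t2 : t * (1 + s) < 1.
  by rewrite -ltr_pdivlMr //; apply: le_lt_trans t1 _; rewrite ltr_pdivrMr // mulr2n mulrDr mulr1 mul1r ltrDl invr_gt0.
have ts : 0 < t * s by rewrite mulr_gt0.
split; apply/square_interior; rewrite !coordE /=; split; apply/andP; split; lra.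
Qed.

Lemma corner_ray_eps s : 0 < s -> 0 < (1 + s)^-1 / 2 :> R.
Proof. by move=> s0; rewrite divr_gt0 // invr_gt0 addr_gt0. Qed.

End Rays.

Lemma convex_comb_gt0 (R : realDomainType) (b l x y z t : R) :
  0 < b < 1 -> 0 < l < 1 -> 0 <= x -> 0 <= y -> 0 <= z -> 0 <= t ->
  (x = 0 -> y = 0 -> z = 0 -> False) ->
  0 < (1 - b) * ((1 - l) * x + l * y) + b * ((1 - l) * z + l * t).
Proof.
move=> /andP[b0 b1] /andP[l0 l1] x0 y0 z0 t0 nz.
have b1' : 0 < 1 - b by rewrite subr_gt0.
have l1' : 0 < 1 - l by rewrite subr_gt0.
have p1 : 0 <= (1 - l) * x by rewrite pmulr_rge0.
have p2 : 0 <= l * y by rewrite pmulr_rge0.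
have p3 : 0 <= (1 - l) * z by rewrite pmulr_rge0.
have p4 : 0 <= l * t by rewrite pmulr_rge0.
rewrite lt_neqAle eq_sym addr_ge0 ?pmulr_rge0 ?addr_ge0 // andbT.
rewrite paddr_eq0 ?pmulr_rge0 ?addr_ge0 // !mulf_eq0 (gt_eqF b0) (gt_eqF b1') /=.
rewrite !paddr_eq0 // !mulf_eq0 (gt_eqF l0) (gt_eqF l1') /=.
by apply/negP => /andP[/andP[/eqP xz /eqP yz] /andP[/eqP zz _]]; apply: nz.
Qed.

(** * Even permutations and singular corners exclude a convex presentation *)

Section NoConvex.
Variable R : realType.
Variable P : gluing R.
Variable n : nat.
Variables h v : {perm 'I_n}.
Notation SQ := (square_tiled R h v).
Variable rel : face P * (R * R) -> face SQ * (R * R) -> Prop.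
Hypothesis cr : correspondence rel.
Hypothesis cr' : @correspondence R SQ P (fun p q => rel q p).
Variable B : face P.
Hypothesis oneB : forall A : face P, A = B.
Hypothesis convP : convex_polygons P.
Hypothesis glP : translation_gluing P.
Variable c0 : R * R.
Hypothesis offset : forall y i x, rel (B, y) (i, x) -> intp (x - y - c0).
Hypothesis n_ge4 : (4 <= n)%N.
Hypothesis n_even : ~~ odd n.
Hypothesis h_even : odd_perm h = false.
Hypothesis v_even : odd_perm v = false.
(** The form in which cone angles are known here: every corner is the origin of two squares, so two
    rays leave it in each direction of the first quadrant. *)
Hypothesis sing : forall i x, @region R SQ i x -> intp x -> exists j1 j2,
  [/\ j1 != j2, @same_point R SQ (i, x) (j1, 0) & @same_point R SQ (i, x) (j2, 0)].
Implicit Types (x y u w : R * R) (i j : 'I_n).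
Notation lattice := (lattice c0).

Lemma origin_region i : @region R SQ i 0.
Proof. by apply/square_region; rewrite /= !lexx !ler01. Qed.

(** Two rays in direction (1, 1) leave the corner under such a point, into different squares. An
    interior point is identified with no other, so both would lift to one and the same ray of P. *)
Lemma lattice_not_interior y : lattice y -> ~ interior B y.
Proof.
move=> ly iy; have ry := interior_region iy.
have [[i x] r] := corr_total cr ry.
have ix : intp x by rewrite -(rel_lattice offset r).
have [_ rx] := corr_region cr r.
have [j1 [j2 [j12 s1 s2]]] := sing rx ix.
have e0 := corner_ray_eps (@ltr01 R).
have ray j := @ray_over_exists _ _ _ h v _ cr' B oneB j 0 (1, 1) _ (@origin_region j) e0
  (fun t ht => (@corner_ray R n h v j _ ltr01 _ ht).1).
have [y1 [t1 [t10 R1]]] := ray j1; have [y2 [t2 [_ R2]]] := ray j2.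
have E j z t : same_point ((i, x) : face SQ * _) (j, 0) -> ray_over rel B j 0 (1, 1) z t -> z = y.
  move=> s rz; have /(corr_same cr r (ray_over_start rz)) := s.
  by move=> /(same_interior glP iy) [].
have y1E := E _ _ _ s1 R1; have y2E := E _ _ _ s2 R2; subst y1 y2.
apply: (rays_over_neq cr j12 (fun t ht => (@corner_ray R n h v j1 _ ltr01 _ ht).1) t10 R1 R2).
by exists 1 => // t _; apply: same_refl.
Qed.

Lemma int_half (a b : R) : a \is a Num.int -> b \is a Num.int ->
  odd `|Num.floor a|%N = odd `|Num.floor b|%N ->
  exists2 m, m \is a Num.int & b = a + 2 * m.
Proof.
move=> /intrP[p ->] /intrP[q ->]; rewrite !intrKfloor => pq.
have [m qE] : exists m : int, q = p + 2 * m by exists ((q - p) %/ 2)%Z; lia.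
by exists m%:~R; rewrite ?intr_int // qE intrD intrM.
Qed.

(* Each square gives one lattice point from which the generic direction [(1, s)]
   points into [P], and one with the opposite direction; they differ because
   lattice points are not interior.  Five lattice points suffice for two of them to
   be congruent modulo 2. *)
Lemma congruent_lattice_points : exists a b, exists2 w, [/\ region B a, region B b,
  lattice a, lattice b & a != b] & intp w /\ b = a + scale 2 w.
Proof.
have [s s0 gen] := generic_slope convP.
have e0 := corner_ray_eps s0.
have ray j := @ray_over_exists _ _ _ h v _ cr' B oneB j 0 (1, s) _ (@origin_region j) e0
  (fun t ht => (@corner_ray R n h v j _ s0 _ ht).1).
have /choice [Y /choice [T HY]] := ray.
have [i0 _] : exists i0 : 'I_n, True by exists (Ordinal (leq_trans (isT : (0 < 4)%N) n_ge4)).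
have r11 : @region R SQ i0 (1, 1) by apply/square_region; rewrite /= !lexx !ler01.
have [y' [t' [t'0 R']]] := @ray_over_exists _ _ _ h v _ cr' B oneB i0 (1, 1) (- (1, s)) _
  r11 e0 (fun t ht => (@corner_ray R n h v i0 _ s0 _ ht).2).
have latY j : lattice (Y j).
  by rewrite (rel_lattice offset (ray_over_start (HY j).2)) intp0.
have laty' : lattice y'.
  by rewrite (rel_lattice offset (ray_over_start R')) /intp rpred1.
have Yinj : injective Y.
  move=> i j Yij; apply/eqP; apply: contraT => ij; exfalso.
  apply: (rays_over_neq cr ij (fun t ht => (@corner_ray R n h v i _ s0 _ ht).1) (HY i).1 (HY i).2 (HY j).2).
  by rewrite Yij; exists 1 => // t _; apply: same_refl.
(* A lattice point lies on some edge line, with P on one side of it; the transversal directions (1,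
   s) and - (1, s) cannot both point into P there. *)
have Yy' j : Y j != y'.
  apply/eqP => E; have [ry rt] := ray_over_region cr (HY j).2.
  have [_ rt'] := ray_over_region cr R'; have [t0 _] := (HY j).2; have [t'0' _] := R'.
  have [e se] := not_interior_side ry (lattice_not_interior (latY j)).
  have := rt e (oneB _); have := rt' e (oneB _).
  rewrite -!/(side _ _) !side_add -E se !add0r !crossZr crossNr !pmulr_rge0 // => k1 k2.
  have := gen e; apply/negP; rewrite negbK; apply/eqP; lra.
pose F (o : option 'I_n) := if o is Some j then Y j else y'.
have Finj : injective F.
  by move=> [i|] [j|] //= => [/Yinj ->|/eqP|/esym/eqP] //; rewrite (negbTE (Yy' _)).
have Freg o : region B (F o).
  by case: o => [j|] /=; [case: (ray_over_region cr (HY j).2)|case: (ray_over_region cr R')].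
have Flat o : lattice (F o) by case: o => [j|] /=.
pose par o := (odd `|Num.floor (F o + c0)%R.1|%N, odd `|Num.floor (F o + c0)%R.2|%N).
have : ~~ injectiveb par.
  apply/negP => /injectiveP /leq_card; rewrite card_option card_ord card_prod card_bool.
  by rewrite leqNgt ltnS n_ge4.
move=> /injectivePn [o [o' oo' [p1 p2]]].
have /andP[a1 a2] := Flat o; have /andP[b1 b2] := Flat o'.
have [m1 im1 E1] := int_half a1 b1 p1; have [m2 im2 E2] := int_half a2 b2 p2.
exists (F o), (F o'), (m1, m2); split=> //.
- by apply: contra oo' => /eqP/Finj ->.
- by rewrite /intp im1.
- by move: E1 E2; rewrite !coordE => E1 E2; apply: pair_ext; rewrite !coordE /=; lra.
Qed.

(* The sides [e] and [glue e] have the same length, at least twice that of [w].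
   If the opposite side is beyond the next lattice line, the chord in between is
   long enough to contain a lattice point in its interior. *)
Lemma convex_side_absurd (e : edge P) a w w' k : region B a -> region B (a + scale (2 * k) w) ->
  lattice a -> 1 <= k -> intp w -> intp w' -> cross w w' = 1 ->
  side e a = 0 -> codirected w e -> False.
Proof.
move=> ra rb la k1 iw iw' ww' ea cod.
have w0 : w != 0.
  apply/eqP => E; move: ww'; rewrite E /cross !mul0r subrr => /eqP.
  by rewrite eq_sym oner_eq0.
have dw := dot_gt0 w0; have [r r0 eE] := codirectedE w0 cod.
pose lev y := cross w (y - a).
have lev_e y : cross w (y - start e) = lev y.
  move: ea; rewrite /side eE crossZl => /eqP; rewrite mulf_eq0 (gt_eqF r0) /= => /eqP.
  by rewrite /lev /cross !coordE; lra.
have lev_ge0 y : region B y -> 0 <= lev y.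
  by move=> /(_ e (oneB _)); rewrite eE crossZl pmulr_rge0 // lev_e.
have [yL [yR [_ _ _ yE bd]]] := side_width oneB convP w0 cod.
have Nw0 : - w != 0 by rewrite oppr_eq0.
have codN : codirected (- w) (glue e) by rewrite codirected_glue.
have [zL [zR [rzL rzR lz zE _]]] := side_width oneB convP Nw0 codN.
move: zE; rewrite opposite_width //; set T := _ / _ in yE * => zE.
have T2 : 2 <= T.
  have /bd /(_ _)/andP[|_ bR] := rb; first by rewrite lev_e /lev /cross !coordE; ring.
  have /bd /(_ _)/andP[|aL _] := ra; first by rewrite lev_e /lev subrr /cross /=; ring.
  have : 2 * k * dot w w <= T * dot w w.
    by move: bR aL; rewrite yE !dotDr !dotZr; lra.
  by rewrite ler_pM2r //; lra.
have {}ra2 : region B (a + scale 2 w).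
  have -> : a + scale 2 w = a + scale k^-1 (a + scale (2 * k) w - a).
    by apply: pair_ext; rewrite !coordE; field; lra.
  by apply: region_conv => //; rewrite invr_ge0 invf_le1; lra.
(* The opposite side runs in direction [- w], so its last point [zR] comes first along [w]. *)
pose M := zR.
have rM2 : region B (M + scale 2 w).
  have -> : M + scale 2 w = M + scale (2 / T) (zL - M).
    by rewrite /M zE; apply: pair_ext; rewrite !coordE; field; lra.
  by apply: region_conv => //; rewrite divr_ge0 ?ler_pdivrMr; lra.
pose H := lev M.
have lev_le y : region B y -> lev y <= H.
  move=> /(_ (glue e) (oneB _)); rewrite (edge_vec_glue glP) eE crossNl crossZl oppr_ge0 pmulr_rle0 //.
  move: lz; rewrite /H /M zE /lev /cross !coordE; lra.
have [H1|H1] := leP H 1.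
  apply: (strip_absurd cr cr' oneB offset h_even v_even _ n_even iw iw' ww' la) => [|y ry].
    exact: leq_trans n_ge4.
  by rewrite -/(lev y) lev_ge0 //= (le_trans (lev_le _ ry)).
have H0 : 0 < H by lra.
(* The segment from [a] to [M] meets the next lattice line, at level 1, in [q]. Since P contains the
   segments from [a] and from [M] along 2 w, it contains the one from [q]. *)
pose q := a + scale H^-1 (M - a).
have qE : q = a + w' + scale (cross (q - a - w') w') w.
  have nz : cross w w' != 0 by rewrite ww' oner_eq0.
  have := cross_basis (q - a - w') nz; rewrite ww' !divr1.
  have -> : cross w (q - a - w') = 0.
    have -> : q - a = scale H^-1 (M - a) by rewrite /q; apply: pair_ext; rewrite !coordE; ring.
    by rewrite crossBr ww' crossZr -/(lev M) -/H mulVf ?gt_eqF // subrr.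
  set c := cross _ w' => E; apply: pair_ext.
    by have := congr1 fst E; rewrite !coordE /=; lra.
  by have := congr1 snd E; rewrite !coordE /=; lra.
set rho := cross _ w' in qE.
(* [q + scale l w] is the first lattice point strictly after [q]; as l is at most 1, it lies
   strictly inside the chord of length 2. *)
pose l := (Num.floor rho + 1)%:~R - rho.
have /andP[f1 f2] := floor_itv rho.
have l_gt0 : 0 < l by rewrite /l subr_gt0.
have l_le1 : l <= 1 by rewrite /l intrD; lra.
apply: (@lattice_not_interior (q + scale l w)).
  have -> : q + scale l w = a + w' + scale (Num.floor rho + 1)%:~R w.
    by rewrite {1}qE /l; apply: pair_ext; rewrite !coordE; ring.
  have iz : intp (scale (Num.floor rho + 1)%:~R w).
    by case/andP: iw => u1 u2; rewrite /intp !coordE !rpredM ?intr_int.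
  have := intpD (intpD la iw') iz; congr intp; apply: pair_ext; rewrite !coordE; ring.
move=> f _; have fa := ra f (oneB _); have fa2 := ra2 f (oneB _).
have fM := rzR f (oneB _); have fM2 := rM2 f (oneB _).
rewrite -!/(side _ _) in fa fa2 fM fM2.
pose b := H^-1; have b_gt0 : 0 < b by rewrite invr_gt0.
have b_lt1 : b < 1 by rewrite invf_lt1.
have -> : side f (q + scale l w) =
    (1 - b) * ((1 - l / 2) * side f a + l / 2 * side f (a + scale 2 w)) +
    b * ((1 - l / 2) * side f M + l / 2 * side f (M + scale 2 w)).
  by rewrite /q -/b /side /cross !coordE; field.
apply: convex_comb_gt0 => //; rewrite ?b_gt0 //; first by apply/andP; split; lra.
(* If [side f] vanished at these three points, [f] would be parallel to [w] and to [M - a], and [M]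
   would have level 0. *)
move=> z1 z2 z3.
have v0 := edge_vec_neq0 convP f.
have cw : cross (edge_vec f) w = 0.
  by move: z2; rewrite side_add z1 add0r crossZr => /eqP; rewrite mulf_eq0 pnatr_eq0 => /eqP.
have cM : cross (edge_vec f) (M - a) = 0.
  by move: z1 z3; rewrite /side /cross !coordE; lra.
by have := cross_trans0 v0 cw cM; rewrite -/(lev M) -/H => HE; rewrite HE ltxx in H0.
Qed.

(** The factor [k] is the gcd of the coordinates, and Bezout coefficients complete [p] to a basis of
    Z^2. *)
Lemma primitive_vector w : intp w -> w != 0 -> exists p p' k,
  [/\ intp p, intp p', cross p p' = 1, 1 <= k & w = scale k p].
Proof.
case: w => w1 w2 /andP[/= /intrP[a ->] /intrP[b ->]] w0.
have g0 : gcdz a b != 0.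
  rewrite gcdz_eq0; apply: contra w0 => /andP[/eqP -> /eqP ->].
  by apply/eqP/pair_ext.
have [u [t bez]] := Bezoutz a b.
have /dvdzP [a' aE] := dvdz_gcdl a b; have /dvdzP [b' bE] := dvdz_gcdr a b.
set g := gcdz a b in g0 bez aE bE.
have uv : u * a' + t * b' = 1.
  by apply: (mulIf g0); rewrite mulrDl -!mulrA -aE -bE bez mul1r.
exists (a'%:~R, b'%:~R), ((- t)%:~R, u%:~R), g%:~R; split.
- by rewrite /intp !intr_int.
- by rewrite /intp !intr_int.
- by rewrite /cross /= -!intrM -intrB mulrN opprK [_ * u]mulrC [_ * t]mulrC uv.
- by rewrite (ler_int _ 1) -gtz0_ge1 lt_def g0.
- by rewrite aE bE !intrM; apply: pair_ext => /=; rewrite mulrC.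
Qed.

Lemma no_convex_presentation : False.
Proof.
have [a [b [w [ra rb la lb ab] [iw bE]]]] := congruent_lattice_points.
have w0 : w != 0.
  apply: contra ab => /eqP w0; rewrite bE w0; apply/eqP/pair_ext; rewrite !coordE /=; ring.
have rm : region B (a + w).
  have -> : a + w = a + scale 2^-1 (b - a) by rewrite bE; apply: pair_ext; rewrite !coordE; field.
  by apply: region_conv => //; apply/andP; split; lra.
have lm : lattice (a + w) by have := intpD la iw; congr intp; rewrite addrAC.
have [e em] := not_interior_side rm (lattice_not_interior lm).
have ea := ra e (oneB _); have eb := rb e (oneB _); rewrite -!/(side _ _) in ea eb.
move: em eb; rewrite bE !side_add crossZr => em eb.
have cw : cross (edge_vec e) w = 0 by lra.
have ea0 : side e a = 0 by lra.
have eb0 : side e b = 0 by rewrite bE side_add crossZr ea0 cw mulr0 addr0.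
have [p [p' [k [ip ip' pp' k1 wE]]]] := primitive_vector iw w0.
have cp : cross p (edge_vec e) = 0.
  move: cw; rewrite wE crossZr crossC mulrN => /eqP; rewrite oppr_eq0 mulf_eq0.
  by case/orP => [/eqP k0|/eqP //]; move: k1; rewrite k0; lra.
have p0 : p != 0 by apply: contra w0 => /eqP pz; rewrite wE pz; apply/eqP/pair_ext; rewrite !coordE /=; ring.
(* If the edge runs against [p], the roles of [a] and [b] are exchanged and the basis is negated. *)
have [d0|d0|d0] := ltgtP 0 (dot p (edge_vec e)).
- apply: (@convex_side_absurd e a p p' k) => //; last by rewrite /codirected cp eqxx.
  by have <- : b = a + scale (2 * k) p by rewrite bE wE; apply: pair_ext; rewrite !coordE; ring.
- apply: (@convex_side_absurd e b (- p) (- p') k) => //.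
  + by have <- : a = b + scale (2 * k) (- p) by rewrite bE wE; apply: pair_ext; rewrite !coordE; ring.
  + by rewrite intpN.
  + by rewrite intpN.
  + by rewrite crossNl crossNr opprK.
  + rewrite /codirected crossNl cp oppr0 eqxx /=.
    have -> : dot (- p) (edge_vec e) = - dot p (edge_vec e) by rewrite /dot !coordE; ring.
    by rewrite oppr_gt0.
- have := cross0_scale p0 cp; rewrite -d0 mul0r => vE.
  by have /eqP := edge_vec_neq0 convP e; apply; rewrite vE; apply: pair_ext; rewrite !coordE mul0r.
Qed.

End NoConvex.

(** * Corners of squares when h and v do not commute *)

Section Corners.
Variable R : realType.
Variable n : nat.
Variables h v : {perm 'I_n}.
Notation SQ := (square_tiled R h v).
Implicit Types (i j : 'I_n) (x : R * R).

Lemma same_corner_hv i : @same_point R SQ (i, (1, 1)) (v (h i), 0).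
Proof.
apply: same_trans (@same_right R n h v i 1 _) _; first by rewrite lexx ler01.
by apply: (@same_top R n h v (h i) 0); rewrite lexx ler01.
Qed.

Lemma same_corner_vh i : @same_point R SQ (i, (1, 1)) (h (v i), 0).
Proof.
apply: same_trans (@same_top R n h v i 1 _) _; first by rewrite lexx ler01.
by apply: (@same_right R n h v (v i) 0); rewrite lexx ler01.
Qed.

Lemma corner_origin i x : @region R SQ i x -> intp x ->
  exists j, @same_point R SQ (i, x) (j, 0).
Proof.
move=> /square_region [x1 x2] /andP[/int01 /(_ x1) i1 /int01 /(_ x2) i2].
have -> : x = (x.1, x.2) by case: x {x1 x2 i1 i2}.
have z01 : 0 <= (0 : R) <= 1 by rewrite lexx ler01.
case: i1 i2 => -> [] ->.
- by exists i; apply: same_refl.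
- by exists (v i); exact: (@same_top R n h v i 0).
- by exists (h i); exact: (@same_right R n h v i 0).
- by exists (v (h i)); exact: same_corner_hv.
Qed.

(** Going right then up, or up then right, the top right corner of square [k] is the origin of
    [v (h k)] and of [h (v k)]; every corner arises in this way. *)
Lemma corner_twice : (forall j, h (v j) != v (h j)) ->
  forall i x, @region R SQ i x -> intp x -> exists j1 j2,
  [/\ j1 != j2, @same_point R SQ (i, x) (j1, 0) & @same_point R SQ (i, x) (j2, 0)].
Proof.
move=> hv i x rx ix; have [j sj] := corner_origin rx ix.
pose k := (v^-1)%g ((h^-1)%g j); have kj : h (v k) = j by rewrite /k !permKV.
exists j, (v (h k)); split=> //; first by rewrite -kj.
apply: same_trans sj _; rewrite -{1}kj.
by apply: same_trans (same_corner_hv k); apply: same_sym; exact: same_corner_vh.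
Qed.

End Corners.

Lemma h0_v0_noncommuting j : h0 (v0 j) != v0 (h0 j).
Proof.
have [h1 h2 h3 h4] := h0E; have [v1 v2 v3 v4] := v0E.
elim/ord4_ind: j; rewrite -?[@inord 3 0]/(square_label 1) -?[@inord 3 1]/(square_label 2)
  -?[@inord 3 2]/(square_label 3) -?[@inord 3 3]/(square_label 4).
- by rewrite v1 h1 h2 v1 -val_eqE /= !inordK.
- by rewrite v2 h1 h2 v3 -val_eqE /= !inordK.
- by rewrite v3 h4 h3 v4 -val_eqE /= !inordK.
- by rewrite v4 h3 h4 v2 -val_eqE /= !inordK.
Qed.

Lemma h0_even : odd_perm h0 = false.
Proof. by rewrite odd_permM !odd_tperm -!val_eqE /= !inordK. Qed.

Lemma v0_even : odd_perm v0 = false.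
Proof. by rewrite odd_permM !odd_tperm -!val_eqE /= !inordK. Qed.

Lemma card1_face (R : realType) (P : gluing R) : #|face P| = 1%N ->
  exists B : face P, forall A, A = B.
Proof. by move=> /eqP/fintype1P. Qed.

Lemma M0_no_convex_presentation (R : realType) : ~ has_convex_presentation (M0 R).
Proof.
move=> [P [[[convP glP _] /card1_face [B oneB] _] /cut_and_paste_correspondence [rel [cr cr']]]].
have [c0 offset] := lattice_offset_exists cr oneB convP.
apply: (no_convex_presentation cr cr' oneB convP glP offset _ _ h0_even v0_even) => //.
exact: corner_twice h0_v0_noncommuting.
Qed.

(** * Edges of a strictly convex polygon in the order of their directions *)

Section StrictlyConvex.
Variable R : realType.
Variable P : gluing R.
Variable B : face P.
Hypothesis oneB : forall A : face P, A = B.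
Hypothesis convP : convex_polygons P.
Hypothesis glP : translation_gluing P.
Hypothesis strict : forall e : edge P, corner_angle e < pi.
Implicit Types (e f g : edge P) (x y u w : R * R).
Notation samef := (same_face oneB).

Lemma angle_opposite u r : u != 0 -> 0 < r -> angle (- u) (scale r u) = pi.
Proof.
move=> u0 r0; have d0 := dot_gt0 u0; rewrite /angle.
have -> : norm2 (- u) = norm2 u by rewrite /norm2 /dot !coordE; congr Num.sqrt; ring.
have -> : norm2 (scale r u) = r * norm2 u.
  rewrite /norm2.
  have -> : dot (scale r u) (scale r u) = r ^+ 2 * dot u u by rewrite /dot !coordE; ring.
  by rewrite sqrtrM ?sqr_ge0 // sqrtr_sqr gtr0_norm.
have -> : dot (- u) (scale r u) = - (r * dot u u) by rewrite /dot !coordE; ring.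
have -> : norm2 u * (r * norm2 u) = r * dot u u.
  by rewrite mulrCA -expr2 /norm2 sqr_sqrtr // ltW.
by rewrite mulNr divff ?acosN1 // gt_eqF // mulr_gt0.
Qed.

Lemma strict_turn e : 0 < cross (edge_vec e) (edge_vec (nxt e)).
Proof.
have se : side e (start (nxt e)) = 0.
  by rewrite /side -/(edge_vec e) crossuu.
have := region_start convP (samef e (nxt (nxt e))).
rewrite end_startE side_add se add0r le_eqVlt => /orP[/eqP/esym c0|//].
have [r r0 E] := collinear_edges convP (samef e (nxt e)) se c0.
have := strict e; rewrite /corner_angle E angle_opposite ?ltxx //.
exact: edge_vec_neq0.
Qed.

Lemma strict_parallel_unique : parallel_unique P.
Proof.
move=> e f r ef r0 E.
have e0 := edge_vec_neq0 convP e.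
have s1 := region_start convP ef; have s2 := region_start convP (esym ef).
have sf : side e (start f) = 0.
  apply/eqP; rewrite eq_le s1 andbT; move: s2.
  rewrite {1}/side E crossZl pmulr_rge0 //.
  by rewrite -(opprB (start f)) crossNr oppr_ge0.
have prev f' : exists g, nxt g = f'.
  by exists (finv (@nxt R P) f'); rewrite f_finv //; apply: nxt_inj.
(* No vertex lies on the line of [e2] behind its start: by the strict turn there, it would be to the
   right of the edge before [e2]. *)
have back e1 e2 s : start e2 - start e1 = scale s (edge_vec e2) -> s <= 0.
  move=> E2; have [g ge] := prev e2.
  have := region_start convP (samef g e1); rewrite /side.
  have -> : start e1 - start g = edge_vec g - scale s (edge_vec e2).
    by rewrite -E2 /edge_vec ge; apply: pair_ext; rewrite !coordE; ring.
  rewrite crossBr crossuu sub0r crossZr oppr_ge0 -ge pmulr_lle0 //.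
  exact: strict_turn.
have d := cross0_scale e0 sf; set s := _ / _ in d.
have s_ge0 : 0 <= s.
  rewrite -oppr_le0; apply: (back f e); rewrite -opprB d.
  by apply: pair_ext; rewrite !coordE; ring.
have s_le0 : s / r <= 0.
  apply: (back e f); rewrite d E; apply: pair_ext; rewrite !coordE; field; exact: lt0r_neq0.
rewrite pmulr_lle0 ?invr_gt0 // in s_le0.
apply: (start_inj convP ef); apply/esym/eqP; rewrite -subr_eq0 d.
have -> : s = 0 by apply/eqP; rewrite eq_le s_le0 s_ge0.
by rewrite scale0.
Qed.

(** A supporting line with direction strictly between those of two consecutive edges touches P only
    at their common vertex, where the outgoing edge is already [nxt e]. *)
Lemma no_edge_between e f : 0 < cross (edge_vec e) (edge_vec f) ->
  0 < cross (edge_vec f) (edge_vec (nxt e)) -> False.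
Proof.
move=> c1 c2; have c0 := strict_turn e.
pose q := start (nxt e) - start f.
have q1 : cross (edge_vec e) q <= 0.
  have := region_start convP (samef e f); rewrite /side.
  have -> : start f - start e = edge_vec e - q.
    by rewrite /q /edge_vec; apply: pair_ext; rewrite !coordE; ring.
  by rewrite crossBr crossuu sub0r oppr_ge0.
have q2 : cross (edge_vec (nxt e)) q <= 0.
  have := region_start convP (samef (nxt e) f); rewrite /side.
  by rewrite -opprB -/q crossNr oppr_ge0.
have q3 : 0 <= cross (edge_vec f) q by exact: (region_start convP (samef f (nxt e))).
(* The linear relation between three vectors of the plane: [edge_vec f] is a positive combination of
   the two others. *)
have E : cross (edge_vec e) (edge_vec (nxt e)) * cross (edge_vec f) q =
    cross (edge_vec f) (edge_vec (nxt e)) * cross (edge_vec e) q +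
    cross (edge_vec e) (edge_vec f) * cross (edge_vec (nxt e)) q.
  by rewrite /cross; ring.
have k0 : 0 <= cross (edge_vec e) (edge_vec (nxt e)) * cross (edge_vec f) q.
  by rewrite mulr_ge0 // ltW.
have k1 : cross (edge_vec f) (edge_vec (nxt e)) * cross (edge_vec e) q <= 0.
  by rewrite pmulr_rle0.
have k2 : cross (edge_vec e) (edge_vec f) * cross (edge_vec (nxt e)) q <= 0.
  by rewrite pmulr_rle0.
have /eqP z1 : cross (edge_vec f) (edge_vec (nxt e)) * cross (edge_vec e) q = 0 by lra.
have /eqP z2 : cross (edge_vec e) (edge_vec f) * cross (edge_vec (nxt e)) q = 0 by lra.
move: z1 z2; rewrite !mulf_eq0 (gt_eqF c1) (gt_eqF c2) /= => /eqP z1 /eqP z2.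
have [q0|q0] := eqVneq q 0.
  have fe : f = nxt e.
    apply: (start_inj convP); first exact: samef.
    by apply/esym/eqP; rewrite -subr_eq0 -/q q0.
  by move: c2; rewrite fe crossuu ltxx.
have := @cross_trans0 _ q (edge_vec e) (edge_vec (nxt e)) q0.
rewrite (crossC (edge_vec e) q) z1 (crossC (edge_vec (nxt e)) q) z2 oppr0 => /(_ erefl erefl) c.
by rewrite c ltxx in c0.
Qed.

(* Negation preserves the cyclic order of the directions, and the next edge is the
   next direction. *)
Lemma glue_nxt e : glue (nxt e) = nxt (glue e).
Proof.
set g1 := glue (nxt e); set g2 := nxt (glue e); pose d := edge_vec (glue e).
have v1 : edge_vec g1 = - edge_vec (nxt e) by apply: edge_vec_glue.
have c1 : 0 < cross d (edge_vec g1).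
  by rewrite v1 /d (edge_vec_glue glP) crossNl crossNr opprK strict_turn.
have c2 : 0 < cross d (edge_vec g2) by exact: strict_turn.
have le1 : cross (edge_vec g1) (edge_vec g2) <= 0.
  by rewrite leNgt; apply/negP => /(no_edge_between c1).
have le2 : 0 <= cross (edge_vec g1) (edge_vec g2).
  rewrite leNgt; apply/negP => lt.
  apply: (@no_edge_between e (glue g2)).
    by rewrite (edge_vec_glue glP) crossNr -crossNl -(edge_vec_glue glP).
  rewrite (edge_vec_glue glP) -[edge_vec (nxt e)]opprK -v1 crossNl crossNr opprK.
  by rewrite crossC oppr_gt0.
have c0 : cross (edge_vec g1) (edge_vec g2) = 0 by apply/eqP; rewrite eq_le le1 le2.
have E := cross0_scale (edge_vec_neq0 convP g1) c0; set r := _ / _ in E.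
apply: (strict_parallel_unique (samef _ _) _ E).
by move: c2; rewrite E crossZr pmulr_lgt0.
Qed.

Lemma iter_nxt_inj m : injective (iter m (@nxt R P)).
Proof. by elim: m => // m IH e f /= /(nxt_inj convP) /IH. Qed.

Lemma reach e f : exists m, f = iter m (@nxt R P) e.
Proof.
have [_ c _ _ _] := convP; exists (findex (@nxt R P) e f).
by rewrite iter_findex // c (samef e f).
Qed.

Lemma glue_iter m e : glue (iter m (@nxt R P) e) = iter m (@nxt R P) (glue e).
Proof. by elim: m => //= m <-; rewrite glue_nxt. Qed.

(** Commuting with the cyclic permutation [nxt], [glue] is one of its powers; as it is an
    involution, the least exponent is half the number of edges. *)
Lemma half_turn : exists k, (forall f, glue f = iter k (@nxt R P) f) /\
  (forall m f, glue f = iter m (@nxt R P) f -> (k <= m)%N).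
Proof.
have [_ _ /(_ B)[e _] _ _] := convP.
have ex : exists m, glue e == iter m (@nxt R P) e.
  by have [m ->] := reach e (glue e); exists m.
exists (ex_minn ex); case: ex_minnP => k /eqP ke kmin; split=> [f|m f].
  by have [i ->] := reach e f; rewrite glue_iter ke -!iterD addnC.
have [i ->] := reach e f; rewrite glue_iter -iterD addnC iterD => /iter_nxt_inj h.
by apply: kmin; rewrite h.
Qed.

Variable k : nat.
Hypothesis half : forall f, glue f = iter k (@nxt R P) f.
Hypothesis half_min : forall m f, glue f = iter m (@nxt R P) f -> (k <= m)%N.

Lemma iter_double_half f : iter (k + k) (@nxt R P) f = f.
Proof. by rewrite iterD -!half glueK. Qed.

Lemma iter_neq m f : (0 < m <= k)%N -> iter m (@nxt R P) f != f.
Proof.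
move=> /andP[m0 mk]; apply/eqP => E.
have : glue f = iter (k - m) (@nxt R P) f.
  by rewrite half -[in LHS](subnK mk) iterD E.
by move=> /half_min; lia.
Qed.

Lemma half_ge2 : (2 <= k)%N.
Proof.
have [_ _ /(_ B)[e _] _ _] := convP; have := strict_turn e.
have := edge_vec_glue glP e; rewrite half; case: (k) => [|[|m]] //= E.
  have /eqP := edge_vec_neq0 convP e; case.
  by have := congr1 fst E; have := congr1 snd E; rewrite !coordE => a b; apply: pair_ext => /=; lra.
by rewrite E crossNr crossuu oppr0 ltxx.
Qed.

Definition vec e m := edge_vec (iter m (@nxt R P) e).

Lemma vec_half e m : vec e (k + m) = - vec e m.
Proof. by rewrite /vec iterD -half (edge_vec_glue glP). Qed.

Lemma vec_shift e i m : vec (iter i (@nxt R P) e) m = vec e (i + m).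
Proof. by rewrite /vec addnC iterD. Qed.

(** The direction of [glue e], opposite to that of [e], is not passed between two consecutive edges,
    and reaching it or the direction of [e] before step k would contradict the minimality of k. *)
Lemma half_plane0 e m : (0 < m < k)%N -> 0 < cross (vec e 0) (vec e m).
Proof.
elim: m => // m IH /andP[_ mk]; have [->|m0] := posnP m; first exact: strict_turn.
have {}IH := IH (introT andP (conj m0 (ltnW mk))).
have ge : 0 <= cross (vec e 0) (vec e m.+1).
  rewrite leNgt; apply/negP => lt.
  apply: (@no_edge_between (iter m (@nxt R P) e) (glue e)).
    by rewrite (edge_vec_glue glP) crossNr -crossC.
  by rewrite (edge_vec_glue glP) crossNl oppr_gt0.
rewrite lt_neqAle ge andbT; apply/eqP => /esym c0.
have E := cross0_scale (edge_vec_neq0 convP e) c0; set r := _ / _ in E.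
have [r0|r0|r0] := ltgtP r 0.
- have : glue e = iter m.+1 (@nxt R P) e.
    apply: (@strict_parallel_unique _ _ (- r)); [exact: samef | by rewrite oppr_gt0 |].
    rewrite -[edge_vec (iter _ _ _)]/(vec e m.+1) E (edge_vec_glue glP).
    by apply: pair_ext; rewrite !coordE; ring.
  by move=> /half_min; lia.
- have : e = iter m.+1 (@nxt R P) e.
    by apply: (@strict_parallel_unique _ _ r); [exact: samef | |].
  by move/esym/eqP; apply/negP/iter_neq; lia.
- have /eqP := edge_vec_neq0 convP (iter m.+1 (@nxt R P) e); apply.
  by rewrite -/(vec e m.+1) E r0 scale0.
Qed.

Lemma half_plane e i j : (i < j < i + k)%N -> 0 < cross (vec e i) (vec e j).
Proof.
move=> /andP[ij jk]; have := @half_plane0 (iter i (@nxt R P) e) (j - i).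
by rewrite !vec_shift addn0 subnKC ?(ltnW ij) //; apply; lia.
Qed.

Definition vtx e : face P * (R * R) := (B, start e).

Lemma vtxE e : vtx (nxt e) = vertex_point e.
Proof. by rewrite /vtx /vertex_point (oneB (face_of e)). Qed.

Lemma same_vtx_half e : same_point (vtx e) (vtx (iter k.+1 (@nxt R P) e)).
Proof.
rewrite iterS -half vtxE vertex_pointE.
have := @same_edge_point _ _ glP e 0; rewrite lexx ler01 subr0 => /(_ isT).
congr same_point; rewrite /vtx /edge_point (oneB (face_of e)).
by congr pair; apply: pair_ext; rewrite !coordE; ring.
Qed.

(** Gluing an edge identifies vertices k + 1 steps apart, and two such jumps make two steps around a
    2k-gon. *)
Lemma same_vtx2 e : same_point (vtx e) (vtx (nxt (nxt e))).
Proof.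
apply: same_trans (same_vtx_half e) _.
have := same_vtx_half (iter k.+1 (@nxt R P) e).
have -> : iter k.+1 (@nxt R P) (iter k.+1 (@nxt R P) e) = nxt (nxt e) => //.
have E : (k.+1 + k.+1 = (k + k).+2)%N by lia.
by rewrite -iterD E !iterS iter_double_half.
Qed.

(** For even k the jump by k + 1 is odd; combined with steps of two it reaches the neighbouring
    vertex. *)
Lemma same_vtx_even e f : ~~ odd k -> same_point (vtx e) (vtx f).
Proof.
move=> ek.
have even m g : same_point (vtx g) (vtx (iter m.*2 (@nxt R P) g)).
  elim: m => [|m IH]; first exact: same_refl.
  by apply: same_trans IH _; rewrite doubleS !iterS; exact: same_vtx2.
have one g : same_point (vtx g) (vtx (nxt g)).
  apply: same_trans (same_vtx_half g) _.
  have := even (k./2) (iter k.+1 (@nxt R P) g).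
  rewrite even_halfK // -iterD.
  have -> // : iter (k + k.+1) (@nxt R P) g = nxt g.
  by rewrite addnS iterS iter_double_half.
have [m ->] := reach e f; elim: m => [|m IH]; first exact: same_refl.
by apply: same_trans IH (one _).
Qed.

Lemma around_iter e : around e = iter k.+1 (@nxt R P) e.
Proof. by rewrite /around half iterSr. Qed.

(** In a hexagon [around] advances by four edges out of six. Orbits of three corners replace the
    angle sum 2 pi. *)
Lemma around3 e : k = 3 -> around (around (around e)) = e.
Proof.
move=> k3; rewrite !around_iter -!iterD.
have -> : (k.+1 + k.+1 + k.+1 = k + k + (k + k))%N by lia.
by rewrite iterD !iter_double_half.
Qed.

Lemma cross_sumr (I : Type) (s : seq I) (p : pred I) u (F : I -> R * R) :
  cross u (\sum_(i <- s | p i) F i) = \sum_(i <- s | p i) cross u (F i).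
Proof. by apply: (big_morph (cross u) (crossDr u)); rewrite /cross /= !mulr0 subrr. Qed.

Lemma scale_bool (b : bool) u : scale b%:R u = if b then u else 0.
Proof. by case: b; apply: pair_ext; rewrite !coordE ?mul1r ?mul0r. Qed.

(** The sum runs over all m < k with coefficients 0 and 1, so that vertices are written like the
    other points of a zonotope. *)
Lemma start_iter e j : (j <= k)%N ->
  start (iter j (@nxt R P) e) = start e + \sum_(m < k) scale (m < j)%N%:R (vec e m).
Proof.
move=> jk; have -> : \sum_(m < k) scale (m < j)%N%:R (vec e m) = \sum_(m < j) vec e m.
  by rewrite (big_ord_widen _ _ jk) [RHS]big_mkcond; apply: eq_bigr => m _; rewrite scale_bool.
elim: j {jk} => [|j IH]; first by rewrite big_ord0 addr0.
by rewrite big_ord_recr /= addrA -IH end_startE.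
Qed.

Lemma start_iter_half e j : (j <= k)%N ->
  start (iter (k + j) (@nxt R P) e) =
    start e + \sum_(m < k) scale (j <= m)%N%:R (vec e m).
Proof.
move=> jk; rewrite addnC iterD start_iter // start_iter // -addrA -big_split /=.
congr (_ + _); apply: eq_bigr => m _; rewrite vec_shift vec_half ltn_ord ltnNge.
by case: (j <= m)%N; apply: pair_ext; rewrite !coordE /=; ring.
Qed.

End StrictlyConvex.

(** * The polygon as a zonotope and its parallelogram tiles *)

Section Zonotope.
Variable R : realType.
Variable P : gluing R.
Variable B : face P.
Hypothesis oneB : forall A : face P, A = B.
Hypothesis convP : convex_polygons P.
Hypothesis glP : translation_gluing P.
Hypothesis strict : forall e : edge P, corner_angle e < pi.
Variable k : nat.
Hypothesis half : forall f : edge P, glue f = iter k (@nxt R P) f.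
Hypothesis half_min : forall m (f : edge P), glue f = iter m (@nxt R P) f -> (k <= m)%N.
Implicit Types (e f g : edge P) (x y u w : R * R).

Let cross_pos := half_plane oneB convP glP strict half half_min.

(** For coefficients in [0, 1] this is a point of the Minkowski sum of the first k edges from [e];
    central symmetry makes P such a sum. *)
Definition zonotope_point e (a : nat -> R) : R * R :=
  start e + \sum_(m < k) scale (a m) (vec e m).

Lemma addKsub x y u : (x + y) - (x + u) = y - u.
Proof. by rewrite opprD addrACA subrr add0r. Qed.

Lemma zonotope_side e a j : (j < k)%N ->
  side (iter j (@nxt R P) e) (zonotope_point e a) =
  \sum_(m < k) (a m - (m < j)%N%:R) * cross (vec e j) (vec e m).
Proof.
move=> jk; rewrite /side -/(vec e j) (start_iter e (ltnW jk)) /zonotope_point.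
rewrite addKsub crossBr !cross_sumr -sumrB; apply: eq_bigr => m _.
by rewrite !crossZr mulrBl.
Qed.

Lemma zonotope_side_half e a j : (j < k)%N ->
  side (iter (k + j) (@nxt R P) e) (zonotope_point e a) =
  \sum_(m < k) ((j <= m)%N%:R - a m) * cross (vec e j) (vec e m).
Proof.
move=> jk; rewrite /side -/(vec e (k + j)) (vec_half glP half).
rewrite (start_iter_half glP half e (ltnW jk)) /zonotope_point.
rewrite addKsub crossNl crossBr !cross_sumr opprB -sumrB; apply: eq_bigr => m _.
by rewrite !crossZr mulrBl.
Qed.

Lemma reach_half e f : exists2 j, (j < k)%N &
  f = iter j (@nxt R P) e \/ f = iter (k + j) (@nxt R P) e.
Proof.
have k2 := half_ge2 oneB convP glP strict half.
have [m ->] := reach oneB convP e f.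
have per q r : iter (q * (k + k) + r) (@nxt R P) e = iter r (@nxt R P) e.
  elim: q => [//|q IH]; rewrite mulSn -addnA [(k + k + _)%N]addnC iterD.
  by rewrite (iter_double_half glP half) IH.
rewrite [m](divn_eq m (k + k)) per.
have lt : (m %% (k + k) < k + k)%N by rewrite ltn_mod; lia.
have [mk|mk] := ltnP (m %% (k + k)) k; first by exists (m %% (k + k))%N => //; left.
exists (m %% (k + k) - k)%N; first by lia.
by right; rewrite subnKC.
Qed.

Lemma zonotope_term_ge0 e (a : nat -> R) j m : (j < k)%N -> (m < k)%N -> 0 <= a m <= 1 ->
  0 <= (a m - (m < j)%N%:R) * cross (vec e j) (vec e m) /\
  0 <= ((j <= m)%N%:R - a m) * cross (vec e j) (vec e m).
Proof.
move=> jk mk /andP[a0 a1].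
have [mj|jm|->] := ltngtP m j.
- have c : 0 < cross (vec e m) (vec e j) by apply: cross_pos; lia.
  rewrite crossC !mulrN /= sub0r mulNr opprK; split; last by rewrite mulr_ge0 // ltW.
  by rewrite -mulNr opprB; apply: mulr_ge0; [rewrite subr_ge0|exact: ltW].
- have c : 0 < cross (vec e j) (vec e m) by apply: cross_pos; lia.
  by rewrite /= subr0; split; apply: mulr_ge0; rewrite ?(ltW c) // subr_ge0.
- by rewrite crossuu !mulr0.
Qed.

Lemma zonotope_region e (a : nat -> R) : (forall m, (m < k)%N -> 0 <= a m <= 1) ->
  region B (zonotope_point e a).
Proof.
move=> a01 f _; have [j jk] := reach_half e f; rewrite -/(side _ _).
by case=> ->; [rewrite zonotope_side //|rewrite zonotope_side_half //];
  apply: sumr_ge0 => m _; have [] := zonotope_term_ge0 e jk (ltn_ord m) (a01 _ (ltn_ord m)).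
Qed.

Lemma sumr_gt0 (F : 'I_k -> R) (i : 'I_k) : (forall m, 0 <= F m) -> 0 < F i -> 0 < \sum_m F m.
Proof.
by move=> F0 Fi; rewrite (bigD1 i) //= ltr_wpDr // sumr_ge0.
Qed.

(** The corner of P at [start e] is spanned by [vec e 0] and [vec e k.-1], the edge ending there
    being opposite to the latter; [m0] is strictly between. For each edge, one of the terms 0, [m0],
    [k.-1] of its side sum is positive. *)
Lemma vtx_ray_interior e m0 t : (0 < m0)%N -> (m0.+1 < k)%N -> 0 < t < 1 ->
  interior B (start e + scale t (vec e m0)).
Proof.
move=> m0_gt0 m0k /andP[t0 t1].
pose a m : R := if m == m0 then t else 0.
have k0 : (0 < k)%N by lia.
have m0k' : (m0 < k)%N by lia.
have km : (k.-1 < k)%N by lia.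
have -> : start e + scale t (vec e m0) = zonotope_point e a.
  rewrite /zonotope_point; congr (_ + _).
  rewrite (bigD1 (Ordinal m0k')) //= /a eqxx big1 ?addr0 // => m mm0.
  by rewrite ifF ?scale0 //; apply: contraNF mm0 => /eqP E; apply/eqP/val_inj.
have a01 m : (m < k)%N -> 0 <= a m <= 1.
  by rewrite /a => _; case: ifP => _; rewrite ?lexx ?ler01 ?ltW.
move=> f _; have [j jk] := reach_half e f.
case=> ->; [rewrite zonotope_side //|rewrite zonotope_side_half //].
- have ge m := (zonotope_term_ge0 e jk (ltn_ord m) (a01 _ (ltn_ord m))).1.
  have [j0|j0] := posnP j.
    apply: (@sumr_gt0 _ (Ordinal m0k')) => //=.
    by rewrite /a eqxx j0 /= subr0 mulr_gt0 //; apply: cross_pos; lia.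
  apply: (@sumr_gt0 _ (Ordinal k0)) => //=.
  rewrite /a ifF; last by lia.
  by rewrite j0 sub0r mulN1r -crossC; apply: cross_pos; lia.
- have ge m := (zonotope_term_ge0 e jk (ltn_ord m) (a01 _ (ltn_ord m))).2.
  have [j1|j1] := ltnP j k.-1.
    apply: (@sumr_gt0 _ (Ordinal km)) => //=.
    rewrite /a ifF; last by lia.
    by rewrite (ltnW j1) subr0 mul1r; apply: cross_pos; lia.
  apply: (@sumr_gt0 _ (Ordinal m0k')) => //=.
  rewrite /a eqxx; have -> : (j <= m0)%N = false by lia.
  by rewrite sub0r mulNr -mulrN -crossC mulr_gt0 //; apply: cross_pos; lia.
Qed.

(* The zonotope is tiled by the parallelograms spanned by the edges [i < j] and
   starting at the sum of the edges strictly between them; taking [0 <= a < 1] and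
   [0 < b <= 1] makes the tiles disjoint. *)
Definition tile (i j : nat) (a b : R) (m : nat) : R :=
  (i < m < j)%N%:R + a * (m == i)%:R + b * (m == j)%:R.

Lemma tileE i j a b m : (i < j)%N -> tile i j a b m =
  if m == i then a else if m == j then b else (i < m < j)%N%:R.
Proof.
move=> ij; rewrite /tile; have [->|mi] := eqVneq m i.
  by rewrite ltnn ltn_eqF //= mulr1 mulr0 add0r addr0.
have [->|mj] := eqVneq m j; first by rewrite ltnn andbF mulr0 mulr1 !add0r.
by rewrite !mulr0 !addr0.
Qed.

Lemma tile01 i j a b m : (i < j)%N -> 0 <= a < 1 -> 0 < b <= 1 -> 0 <= tile i j a b m <= 1.
Proof.
move=> ij /andP[a0 a1] /andP[b0 b1]; rewrite tileE //; case: ifP => _; first by rewrite a0 ltW.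
case: ifP => _; first by rewrite b1 ltW.
by case: (_ < _ < _)%N; rewrite lexx ler01.
Qed.

(* The linear form [cross (vec e i)] separates the two tiles, as it is maximal at
   the upper left boundary of the zonotope of the edges before [j]. *)
Lemma tile_neq_lt e i j a b i' j' a' b' : (i < j < k)%N -> (i' < j')%N -> (j' < j)%N ->
  0 <= a < 1 -> 0 < b <= 1 -> 0 <= a' < 1 -> 0 < b' <= 1 ->
  zonotope_point e (tile i j a b) <> zonotope_point e (tile i' j' a' b').
Proof.
move=> /andP[ij jk] ij' jj a01 b01 a01' b01' /addrI /(congr1 (cross (vec e i))).
rewrite !cross_sumr => /eqP; rewrite -subr_eq0 -sumrB => /eqP E.
suff : 0 < \sum_(m < k) (cross (vec e i) (scale (tile i j a b m) (vec e m)) -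
   cross (vec e i) (scale (tile i' j' a' b' m) (vec e m))) by rewrite E ltxx.
have T01 m := @tile01 i' j' a' b' m ij' a01' b01'.
apply: (@sumr_gt0 _ (Ordinal jk)) => [m|] /=; rewrite !crossZr -mulrBl; last first.
  rewrite (tileE _ _ _ ij) (tileE _ _ _ ij') eqxx.
  have -> : (j == i) = false by lia.
  have -> : (j == i') = false by lia.
  have -> : (j == j') = false by lia.
  have -> : (i' < j < j')%N = false by lia.
  by rewrite subr0 mulr_gt0 //; [case/andP: b01 | apply: cross_pos; lia].
have mk := ltn_ord m.
have [mi|im|->] := ltngtP m i; last by rewrite crossuu mulr0.
  rewrite (tileE _ _ _ ij).
  have -> : (m == i :> nat) = false by lia.
  have -> : (m == j :> nat) = false by lia.
  have -> : (i < m < j)%N = false by lia.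
  rewrite sub0r crossC mulrNN mulr_ge0 //; first by have /andP[] := T01 m.
  by apply/ltW/cross_pos; lia.
have c : 0 < cross (vec e i) (vec e m) by apply: cross_pos; lia.
apply: mulr_ge0; last exact: ltW.
rewrite subr_ge0 (tileE _ _ _ ij).
have -> : (m == i :> nat) = false by lia.
have [mj|jm|mj] := ltngtP m j.
- by rewrite im /=; have /andP[] := T01 m.
- rewrite andbF (tileE _ _ _ ij').
  have -> : (m == i' :> nat) = false by lia.
  have -> : (m == j' :> nat) = false by lia.
  by have -> : (i' < m < j')%N = false by lia.
- rewrite (tileE _ _ _ ij').
  have -> : (m == i' :> nat) = false by lia.
  have -> : (m == j' :> nat) = false by lia.
  have -> : (i' < m < j')%N = false by lia.
  by case/andP: b01 => /ltW.
Qed.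

(** For a common last edge [j], the coefficients before [j] do not increase when [i] is replaced by
    the larger [i'], and drop at [i'] because a' < 1; [cross (vec e j)] is negative on all these
    edges. *)
Lemma tile_neq_eq e i j a b i' a' b' : (i < i')%N -> (i' < j < k)%N ->
  0 <= a < 1 -> 0 < b <= 1 -> 0 <= a' < 1 -> 0 < b' <= 1 ->
  zonotope_point e (tile i j a b) <> zonotope_point e (tile i' j a' b').
Proof.
move=> ii /andP[ij' jk] a01 b01 a01' b01' /addrI /(congr1 (cross (vec e j))).
have ij : (i < j)%N by lia.
rewrite !cross_sumr => /eqP; rewrite eq_sym -subr_eq0 -sumrB => /eqP E.
suff : 0 < \sum_(m < k) (cross (vec e j) (scale (tile i' j a' b' m) (vec e m)) -
   cross (vec e j) (scale (tile i j a b m) (vec e m))) by rewrite E ltxx.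
have ik : (i' < k)%N by lia.
have cN m : (m < j)%N -> 0 < - cross (vec e j) (vec e m).
  by move=> mj; rewrite -crossC; apply: cross_pos; lia.
apply: (@sumr_gt0 _ (Ordinal ik)) => [m|] /=; rewrite !crossZr -mulrBl -mulrNN; last first.
  apply: mulr_gt0; last exact: cN.
  rewrite opprB (tileE _ _ _ ij) (tileE _ _ _ ij') eqxx.
  have -> : (i' == i) = false by lia.
  have -> : (i' == j) = false by lia.
  have -> : (i < i' < j)%N by lia.
  by rewrite subr_gt0; case/andP: a01'.
have mk := ltn_ord m.
have [mj|jm|->] := ltngtP m j; last by rewrite crossuu oppr0 mulr0.
  apply: mulr_ge0; last by apply/ltW/cN.
  rewrite opprB subr_ge0 (tileE _ _ _ ij) (tileE _ _ _ ij').
  have -> : (m == j :> nat) = false by lia.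
  have [mi|im|->] := ltngtP m i.
  - have -> : (m == i' :> nat) = false by lia.
    have -> : (i' < m < j)%N = false by lia.
    by rewrite /= lexx.
  - rewrite mj andbT /=; case: eqP => _; first by case/andP: a01' => _ /ltW.
    by case: (i' < m)%N; rewrite ?ler01 ?lexx.
  - have -> : (i == i') = false by lia.
    have -> : (i' < i < j)%N = false by lia.
    by case/andP: a01.
rewrite (tileE _ _ _ ij) (tileE _ _ _ ij').
have -> : (m == j :> nat) = false by lia.
have -> : (m == i :> nat) = false by lia.
have -> : (m == i' :> nat) = false by lia.
have -> : (i < m < j)%N = false by lia.
have -> : (i' < m < j)%N = false by lia.
by rewrite subrr oppr0 mul0r.
Qed.

Lemma tile_inj e i j a b i' j' a' b' : (i < j < k)%N -> (i' < j' < k)%N ->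
  0 <= a < 1 -> 0 < b <= 1 -> 0 <= a' < 1 -> 0 < b' <= 1 ->
  zonotope_point e (tile i j a b) = zonotope_point e (tile i' j' a' b') ->
  (i, j) = (i', j').
Proof.
move=> /andP[ij jk] /andP[ij' jk'] a01 b01 a01' b01' E.
have [jj|jj|jj] := ltngtP j j'.
- have [] := @tile_neq_lt e i' j' a' b' i j a b _ ij jj a01' b01' a01 b01 (esym E).
  by rewrite ij' jk'.
- have [] := @tile_neq_lt e i j a b i' j' a' b' _ ij' jj a01 b01 a01' b01' E.
  by rewrite ij jk.
subst j'; have [ii|ii|->] := ltngtP i i' => //.
- have [] := @tile_neq_eq e i j a b i' a' b' ii _ a01 b01 a01' b01' E.
  by rewrite ij' jk.
- have [] := @tile_neq_eq e i' j a' b' i a b ii _ a01' b01' a01 b01 (esym E).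
  by rewrite ij jk.
Qed.

Lemma zonotope_tileE e i j a b : (i < j < k)%N ->
  zonotope_point e (tile i j a b) =
  zonotope_point e (fun m => (i < m < j)%N%:R) + scale a (vec e i) + scale b (vec e j).
Proof.
move=> /andP[ij jk]; have ik : (i < k)%N := ltn_trans ij jk.
rewrite /zonotope_point -!addrA; congr (_ + _).
have delta c l : (l < k)%N ->
    \sum_(m < k) scale (c * (m == l :> nat)%:R) (vec e m) = scale c (vec e l).
  move=> lk; rewrite (bigD1 (Ordinal lk)) //= eqxx mulr1 big1 ?addr0 // => m ml.
  have -> : (m == l :> nat) = false by apply: contraNF ml => /eqP E; exact/eqP/val_inj.
  by rewrite mulr0 scale0.
rewrite -(delta a i) // -(delta b j) // -!big_split /=; apply: eq_bigr => m _.
by apply: pair_ext; rewrite /tile !coordE; ring.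
Qed.

End Zonotope.

(** * Cone points of square-tiled surfaces in H(1,1) *)

Section SquareCones.
Variable R : realType.
Variable n : nat.
Variables h v : {perm 'I_n}.
Notation SQ := (square_tiled R h v).
Implicit Types (i j : 'I_n) (k : 'I_4) (x : R * R).

Let glS := @square_glue R n h v.
Let convS := @square_convex R n h v.
Let puS := @square_parallel_unique R n h v.

Lemma square_corner_angle (e : edge SQ) : corner_angle e = pi / 2.
Proof.
case: e => i k; rewrite /corner_angle /angle.
have -> : dot (- edge_vec ((i, k) : edge SQ)) (edge_vec (nxt ((i, k) : edge SQ))) = 0.
  rewrite /= !square_edge_vec; elim/ord4_ind: k; rewrite ordS_inord // /square_side /= !inordK //=;
  by rewrite /dot !coordE /=; ring.
by rewrite mul0r acos0.
Qed.

Lemma cone_angle_order (e : edge SQ) : cone_angle e = 4 * pi ->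
  fingraph.order (@around R SQ) e = 8.
Proof.
rewrite /cone_angle; under eq_bigr do rewrite square_corner_angle.
rewrite sumr_const -/(fingraph.order _ _) => E.
have p0 : pi / 2 != 0 :> R by rewrite gt_eqF // divr_gt0 // pi_gt0.
have : (fingraph.order (@around R SQ) e)%:R = 8%:R :> R.
  by apply: (mulIf p0); rewrite [LHS]mulr_natl E; field.
by move/eqP; rewrite eqr_nat => /eqP.
Qed.

Lemma iter_around_side m (e : edge SQ) :
  (iter m (@around R SQ) e).2 = iter m (fun k => ordS (ordS (ordS k))) e.2.
Proof. by elim: m => //= m <-. Qed.

Lemma origin_vertex (e : edge SQ) : e.2 = @inord 3 3 -> vertex_point e = (e.1, 0).
Proof.
case: e => i k /= ->; rewrite /vertex_point /= ordS_inord //= /square_corner /= inordK //.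
Qed.

(** [around] adds 3 to the side index modulo 4, so among the eight right angles of the cone point
    two, four steps apart, are lower left corners. An orbit of length 8 puts them in different
    squares. *)
Lemma cone_origin (e : edge SQ) : cone_angle e = 4 * pi ->
  exists e1 e2 : edge SQ, [/\ fconnect (@around R SQ) e e1, e1.1 != e2.1,
    @same_point R SQ (e1.1, 0) (e2.1, 0) & vertex_point e1 = (e1.1, 0)].
Proof.
move=> /cone_angle_order o8.
have [m side3] : exists m, (iter m (@around R SQ) e).2 = @inord 3 3.
  case: e {o8} => i k; elim/ord4_ind: k; [exists 1%N|exists 2%N|exists 3%N|exists 0%N];
  by rewrite iter_around_side /= ?ordS_inord.
set e1 := iter m _ e in side3; pose e2 := iter 4 (@around R SQ) e1.
have c1 : fconnect (@around R SQ) e e1 by exact: fconnect_iter.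
have o1 : fingraph.order (@around R SQ) e1 = 8.
  rewrite -o8; apply/esym/eq_card/same_connect => //.
  exact: (fconnect_sym (around_inj glS convS)).
have side3' : e2.2 = @inord 3 3.
  by rewrite /e2 iter_around_side side3 /= !ordS_inord.
exists e1, e2; split=> //; last exact: origin_vertex.
  apply/eqP => E; have e12 : e2 = e1.
    by rewrite [LHS]surjective_pairing [RHS]surjective_pairing E side3 side3'.
  have := @findex_iter _ (@around R SQ) e1 4; rewrite o1 -/e2 e12 findex0 => /(_ isT).
  by [].
rewrite -(origin_vertex side3) -(origin_vertex side3').
by apply: (same_vertex glS convS); exact: fconnect_iter.
Qed.

Lemma H11_origins : in_H11 SQ -> exists i1 j1 i2 j2,
  [/\ i1 != j1, @same_point R SQ (i1, 0) (j1, 0),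
      i2 != j2, @same_point R SQ (i2, 0) (j2, 0)
    & ~ @same_point R SQ (i1, 0) (i2, 0)].
Proof.
move=> [_ _ [e1 [e2 [nc /cone_origin [f1 [g1 [c1 n1 s1 o1]]] /cone_origin [f2 [g2 [c2 n2 s2 o2]]] _]]]].
exists f1.1, g1.1, f2.1, g2.1; split=> //.
rewrite -o1 -o2 => /(same_pointP glS convS puS) [|e t t01 E _|e f c E1 E2].
- move=> /(vertex_point_inj convS) f12; case/negP: nc; apply: connect_trans c1 _.
  by rewrite f12 (fconnect_sym (around_inj glS convS)).
- by have := edge_vertex_neq convS puS t01 (esym E).
- have := vertex_point_inj convS E1; have := vertex_point_inj convS E2 => ? ?; subst e f.
  case/negP: nc; apply: connect_trans c1 (connect_trans c _).
  by rewrite (fconnect_sym (around_inj glS convS)).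
Qed.

End SquareCones.

(** * Strictly convex presentations need at least ten squares *)

Section NoStrictlyConvex.
Variable R : realType.
Variable P : gluing R.
Variable n : nat.
Variables h v : {perm 'I_n}.
Notation SQ := (square_tiled R h v).
Variable rel : face P * (R * R) -> face SQ * (R * R) -> Prop.
Hypothesis cr : correspondence rel.
Hypothesis cr' : @correspondence R SQ P (fun p q => rel q p).
Variable B : face P.
Hypothesis oneB : forall A : face P, A = B.
Hypothesis convP : convex_polygons P.
Hypothesis glP : translation_gluing P.
Hypothesis strict : forall e : edge P, corner_angle e < pi.
Variable c0 : R * R.
Hypothesis offset : forall y i x, rel (B, y) (i, x) -> intp (x - y - c0).
Variable k : nat.
Hypothesis half : forall f : edge P, glue f = iter k (@nxt R P) f.
Hypothesis half_min : forall m (f : edge P), glue f = iter m (@nxt R P) f -> (k <= m)%N.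
Implicit Types (e f g : edge P) (x y u w : R * R) (i j : 'I_n).
Notation lattice := (lattice c0).

Let puP := strict_parallel_unique oneB convP strict.

(** Two rays in one generic direction leave the singular point, and their starts in P are
    identified. They are not one point, and not glued points inside edges, since no direction points
    inwards on both sides of an edge; so they are vertices, and for the same reason not consecutive
    under [around]. *)
Lemma singular_vertex i j : i != j -> @same_point R SQ (i, 0) (j, 0) ->
  exists e f, [/\ rel (vtx B (nxt e)) (i, 0), fconnect (@around R P) e f, e <> f,
    f <> around e & e <> around f].
Proof.
move=> ij sij; have [s s0 gen] := generic_slope convP.
have e0 := corner_ray_eps s0.
have ray l := @ray_over_exists _ _ _ h v _ cr' B oneB l 0 (1, s) _ (@origin_region R n h v l) e0
  (fun t ht => (@corner_ray R n h v l _ s0 _ ht).1).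
have [y1 [t1 [t10 R1]]] := ray i; have [y2 [t2 [_ R2]]] := ray j.
have nofold : ~ exists2 t3, 0 < t3 & forall t, 0 <= t <= t3 ->
    same_point (B, y1 + scale t (1, s)) (B, y2 + scale t (1, s)).
  exact: (rays_over_neq cr ij (fun t ht => (@corner_ray R n h v i _ s0 _ ht).1) t10 R1 R2).
have s12 : same_point (B, y1) (B, y2).
  by apply/(corr_same cr (ray_over_start R1) (ray_over_start R2)).
have [_ rt1] := ray_over_region cr R1; have [_ rt2] := ray_over_region cr R2.
have inward e y t : 0 < t -> region B (y + scale t (1, s)) -> side e y = 0 ->
    0 < cross (edge_vec e) (1, s).
  move=> t0 /(_ e (oneB _)); rewrite -/(side _ _) side_add crossZr => + E.
  by rewrite E add0r pmulr_rge0 // lt_def gen.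
have t1_gt0 : 0 < t1 by case: R1.
have t2_gt0 : 0 < t2 by case: R2.
case: (same_pointP glP convP puP s12) => [[E]|e t t01 [_ E1] [_ E2]|e f c E1 E2].
- by case: nofold; rewrite -E; exists 1 => // t _; apply: same_refl.
- have k1 : 0 < cross (edge_vec e) (1, s).
    by apply: (inward e y1 t1 t1_gt0 rt1); rewrite E1; exact: (side_edge_point e t).
  have k2 : 0 < cross (edge_vec (glue e)) (1, s).
    by apply: (inward _ y2 t2 t2_gt0 rt2); rewrite E2; exact: (side_edge_point (glue e) (1 - t)).
  by move: k2; rewrite (edge_vec_glue glP) crossNl oppr_gt0 => k2; have := lt_trans k1 k2; rewrite ltxx.
- have [_ y1E] := E1; have [_ y2E] := E2.
  (* The ends of [g] and of [around g] lie on the glued edges [nxt g] and [glue (nxt g)], whose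
     inward sides are opposite. *)
  have adj g g' y y' tt tt' : y = start (nxt g) -> y' = start (nxt g') -> 0 < tt -> 0 < tt' ->
      region B (y + scale tt (1, s)) -> region B (y' + scale tt' (1, s)) -> g' <> around g.
    move=> yE yE' tt0 tt0' r r' ga.
    have k1 : 0 < cross (edge_vec (nxt g)) (1, s).
      apply: (inward _ y tt tt0 r); rewrite yE /side subrr /cross /=; ring.
    have k2 : 0 < cross (edge_vec g') (1, s).
      by apply: (inward _ y' tt' tt0' r'); rewrite yE' /side -/(edge_vec g') crossuu.
    move: k2; rewrite ga /around (edge_vec_glue glP) crossNl oppr_gt0 => k2.
    by have := lt_trans k1 k2; rewrite ltxx.
  exists e, f; split.
  + by rewrite /vtx -y1E; exact: (ray_over_start R1).
  + exact: c.
  + move=> ef; case: nofold; rewrite y1E y2E ef.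
    by exists 1 => // t _; apply: same_refl.
  + exact: (adj e f y1 y2 t1 t2).
  + exact: (adj f e y2 y1 t2 t1).
Qed.

Lemma half_odd i1 j1 i2 j2 :
  i1 != j1 -> @same_point R SQ (i1, 0) (j1, 0) ->
  i2 != j2 -> @same_point R SQ (i2, 0) (j2, 0) ->
  ~ @same_point R SQ (i1, 0) (i2, 0) -> odd k.
Proof.
move=> n1 s1 n2 s2 ns; apply: contraT => ek; case: ns.
have [e1 [_ [r1 _ _ _ _]]] := singular_vertex n1 s1.
have [e2 [_ [r2 _ _ _ _]]] := singular_vertex n2 s2.
apply/(corr_same cr r1 r2).
exact: (same_vtx_even oneB convP glP half).
Qed.

(** In a hexagon any two corners of an orbit of [around] are consecutive, which a singular point
    forbids. *)
Lemma half_neq3 i j : i != j -> @same_point R SQ (i, 0) (j, 0) -> k <> 3.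
Proof.
move=> n1 s1 k3; have [e [f [_ c ef fe1 ef1]]] := singular_vertex n1 s1.
have [m fE] : exists m, f = iter m (@around R P) e.
  by exists (findex (@around R P) e f); rewrite iter_findex.
have per q r : iter (q * 3 + r) (@around R P) e = iter r (@around R P) e.
  elim: q => [//|q IH]; rewrite mulSn -addnA iterD IH.
  by rewrite /= (around3 glP half _ k3).
move: fE; rewrite [m](divn_eq m 3) per.
have : (m %% 3 < 3)%N by rewrite ltn_mod.
case: (m %% 3)%N => [|[|[|//]]] _ /= fE.
- by case: ef.
- by case: fe1.
- by case: ef1; rewrite fE (around3 glP half _ k3).
Qed.

Hypothesis k5 : (5 <= k)%N.

(* The vertices [start e] and [start (nxt (nxt e))] are identified and have the
   inward direction [vec e 3] in common, which cannot happen over a point of the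
   square-tiled surface that is not a corner. *)
Lemma lattice_vertex e : lattice (start e).
Proof.
(* Index 3 from [e] is index 1 from [nxt (nxt e)]; both lie strictly between 0 and k - 1 because k
   is at least 5. *)
pose u := vec e 3.
have k2 : (2 <= k)%N by lia.
have int1 t : 0 < t < 1 -> interior B (start e + scale t u).
  by apply: (vtx_ray_interior oneB convP glP strict half half_min); lia.
have int2 t : 0 < t < 1 -> interior B (start (nxt (nxt e)) + scale t u).
  have -> : u = vec (nxt (nxt e)) 1 by [].
  by apply: (vtx_ray_interior oneB convP glP strict half half_min); lia.
have half01 : 0 < (2^-1 : R) < 1 by apply/andP; split; lra.
have h0 : 0 < (2^-1 : R) by case/andP: half01.
have r1 := interior_region (int1 _ half01); have r2 := interior_region (int2 _ half01).
have [t1 /andP[t1_gt0 t1h] [C1 [x1 H1]]] := corr_ray cr (region_vertex oneB convP e) h0 r1.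
have [t2 /andP[t2_gt0 t2h] [C2 [x2 H2]]] := corr_ray cr (region_vertex oneB convP (nxt (nxt e))) h0 r2.
have q1 : rel (B, start e) (C1, x1).
  by have := H1 0; rewrite lexx (ltW t1_gt0) !scale0 !addr0; apply.
have q2 : rel (B, start (nxt (nxt e))) (C2, x2).
  by have := H2 0; rewrite lexx (ltW t2_gt0) !scale0 !addr0; apply.
rewrite (rel_lattice offset q1); apply: contraT => nx1.
have s12 : same_point (C1, x1) (C2, x2).
  by apply/(corr_same cr q1 q2)/(same_vtx2 oneB glP half).
pose t0 := Num.min t1 t2.
have t0_gt0 : 0 < t0 by rewrite lt_min t1_gt0.
have a1 : t0 <= t1 by rewrite ge_min lexx.
have a2 : t0 <= t2 by rewrite ge_min lexx orbT.
have [t3 t3_gt0 H3] : exists2 t3, 0 < t3 & forall t, 0 <= t <= t3 ->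
    same_point (C1, x1 + scale t u) (C2, x2 + scale t u).
  apply: (fold_germ (@square_glue R n h v) (@square_convex R n h v)
    (@square_parallel_unique R n h v) t0_gt0) => //.
  - by move=> g E; case/negP: nx1; have := square_vertex_int g; rewrite -E.
  - by have := H1 t0; rewrite (ltW t0_gt0) a1 => /(_ isT) /(corr_region cr)[].
  - by have := H2 t0; rewrite (ltW t0_gt0) a2 => /(_ isT) /(corr_region cr)[].
pose t := Num.min t0 t3.
have t_gt0 : 0 < t by rewrite lt_min t0_gt0.
have b0 : t <= t0 by rewrite ge_min lexx.
have b3 : t <= t3 by rewrite ge_min lexx orbT.
have t01 : 0 < t < 1 by rewrite t_gt0; lra.
have e1 := H1 t; have e2 := H2 t; have := H3 t; move: e1 e2.
rewrite (ltW t_gt0) b3 (le_trans b0 a1) (le_trans b0 a2) => /(_ isT) e1 /(_ isT) e2 /(_ isT) s.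
have /(corr_same cr e1 e2) /(same_interior glP (int1 _ t01)) /(congr1 snd) /= /addIr E := s.
have /(start_inj convP (same_face oneB _ _)) : start (nxt (nxt e)) = start e by [].
by move=> E2; have := @iter_neq _ _ _ half half_min 2 e; rewrite k2 /= E2 eqxx => /(_ isT).
Qed.

Lemma lattice_vec e m : intp (vec e m).
Proof.
have := intpB (lattice_vertex (iter m.+1 (@nxt R P) e)) (lattice_vertex (iter m (@nxt R P) e)).
by congr intp; rewrite /vec /edge_vec; apply: pair_ext; rewrite !coordE; ring.
Qed.

Lemma tile_meets_coset e (i j : nat) z : (i < j < k)%N ->
  exists a b, [/\ 0 <= a < 1, 0 < b <= 1
    & intp (z - zonotope_point k e (tile i j a b) - c0)].
Proof.
move=> ijk; have c : cross (vec e i) (vec e j) != 0.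
  by rewrite gt_eqF //; apply: (half_plane oneB convP glP strict half half_min); lia.
set q := zonotope_point k e (fun m => (i < m < j)%N%:R).
have iq : intp (q + c0).
  have : intp (\sum_(m < k) scale (i < m < j)%N%:R (vec e m)).
    apply: (big_ind (fun x => intp x : Prop)) => [|x y|m _];
      [exact: intp0|exact: intpD|].
    by rewrite scale_bool; case: ifP => _; [exact: lattice_vec|exact: intp0].
  move=> is_int; have := intpD (lattice_vertex e) is_int; congr intp.
  by rewrite /q /zonotope_point addrAC.
pose zz := z - (q + c0).
have zE := cross_basis zz c; set al := _ / _ in zE; set be := cross _ zz / _ in zE.
(* Floor and ceiling are chosen to match the half-open tile: a in [0, 1) and b in (0, 1]. *)
pose a := al - (Num.floor al)%:~R; pose b := be - (Num.ceil be - 1)%:~R.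
have /andP[f1 f2] := floor_itv al; have /andP[g1 g2] := ceil_itv be.
exists a, b; split.
- by rewrite /a subr_ge0 f1 ltrBlDl; move: f2; rewrite intrD.
- by rewrite /b subr_gt0 g1 /= lerBlDl; move: g2; rewrite intrB; lra.
rewrite zonotope_tileE // -/q.
have ii : intp (scale (Num.floor al)%:~R (vec e i) + scale (Num.ceil be - 1)%:~R (vec e j)).
  have /andP[u1 u2] := lattice_vec e i; have /andP[w1 w2] := lattice_vec e j.
  by rewrite /intp !coordE !rpredD ?rpredM ?intr_int.
move: ii; congr intp.
have -> : z = zz + (q + c0) by rewrite /zz subrK.
by rewrite zE /a /b; apply: pair_ext; rewrite !coordE; ring.
Qed.

(** Every tile contains a point over the coset of the generic [z], and all these points are interior
    to P. Two of them over the same square are therefore equal and lie in one tile. *)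
Lemma large_area : (10 <= n)%N.
Proof.
have [_ _ /(_ B)[e _] _ _] := convP.
have iv (f : edge P) : intp (edge_vec f) := lattice_vec f 0.
have [z [z1 z2 nz]] := generic_point iv (edge_vec_neq0 convP).
(* The ten pairs among the first five edges. *)
pose pairs := [:: (0, 1); (0, 2); (0, 3); (0, 4); (1, 2); (1, 3); (1, 4); (2, 3); (2, 4); (3, 4)]%N.
have pairs_lt p : p \in pairs -> (p.1 < p.2 < k)%N.
  move=> pin; have : (p.1 < p.2 < 5)%N by move: p pin; apply/allP.
  by case/andP=> -> /leq_trans; apply.
pose good (p : nat * nat) (i : 'I_n) := exists a b, [/\ 0 <= a < 1, 0 < b <= 1,
   rel (B, zonotope_point k e (tile p.1 p.2 a b)) (i, z)
   & interior B (zonotope_point k e (tile p.1 p.2 a b))].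
have ex p : exists i, p \in pairs -> good p i.
  have [pin|] := boolP (p \in pairs); last first.
    move=> _; have [[i x] _] := corr_total cr (region_vertex oneB convP e).
    by exists i.
  have [a [b [a01 b01 iz]]] := tile_meets_coset e z (pairs_lt p pin).
  set y := zonotope_point _ _ _ in iz.
  have ry : region B y.
    apply: (zonotope_region oneB convP glP strict half half_min) => m _.
    by apply: tile01 => //; case/andP: (pairs_lt p pin).
  have [[i x] r] := corr_total cr ry.
  have [_ /square_region [x1 x2]] := corr_region cr r.
  (* [x] is in the closed unit square, [z] in the open one, and they are congruent modulo Z^2. *)
  have xz : x = z.
    have := intpB (offset r) iz.
    have -> : x - y - c0 - (z - y - c0) = x - z by apply: pair_ext; rewrite !coordE; ring.
    move: x1 x2 z1 z2 => /andP[? ?] /andP[? ?] /andP[? ?] /andP[? ?].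
    move=> /andP[/int_small i1 /int_small i2].
    apply: pair_ext; apply/eqP; rewrite -subr_eq0; apply/eqP;
      [apply: i1|apply: i2]; rewrite !coordE; apply/andP; split; lra.
  exists i => _; exists a, b; rewrite -/y; split=> //; first by rewrite -xz.
  move=> f fB; rewrite lt_def ry // andbT; apply: contra (nz f) => /eqP s0.
  have -> : cross (edge_vec f) z =
      cross (edge_vec f) (z - y - c0) + cross (edge_vec f) (start f + c0) + side f y.
    by rewrite /side /cross !coordE; ring.
  rewrite s0 addr0; apply: rpredD; apply: intp_cross => //; exact: lattice_vertex.
have [L HL] := choice ex.
have Linj : {in pairs &, injective L}.
  move=> p p' pin pin' LE.
  have [a [b [a01 b01 r iy]]] := HL p pin; have [a' [b' [a01' b01' r' _]]] := HL p' pin'.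
  have : same_point (B, zonotope_point k e (tile p.1 p.2 a b))
                    (B, zonotope_point k e (tile p'.1 p'.2 a' b')).
    by apply/(corr_same cr r r'); rewrite LE; apply: same_refl.
  move=> /(same_interior glP iy) /(congr1 snd) /= E.
  have := tile_inj oneB convP glP strict half half_min (pairs_lt p' pin') (pairs_lt p pin)
    a01' b01' a01 b01 E.
  by rewrite -!surjective_pairing => ->.
have := max_card (mem (map L pairs)); rewrite card_ord.
by rewrite (card_uniqP _) ?size_map // map_inj_in_uniq.
Qed.

End NoStrictlyConvex.

Lemma small_H11_no_strictly_convex_presentation (R : realType) n (h v : {perm 'I_n}) :
  (n <= 7)%N -> in_H11 (square_tiled R h v) ->
  ~ has_strictly_convex_presentation (square_tiled R h v).
Proof.
move=> n7 /H11_origins [i1 [j1 [i2 [j2 [n1 s1 n2 s2 ns]]]]].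
move=> [P [[[convP glP _] /card1_face [B oneB] _] strict
  /cut_and_paste_correspondence [rel [cr cr']]]].
have [c0 offset] := lattice_offset_exists cr oneB convP.
have [k [half half_min]] := half_turn oneB convP glP strict.
have ok := half_odd cr cr' oneB convP glP strict half n1 s1 n2 s2 ns.
have k3 := half_neq3 cr cr' oneB convP glP strict half n1 s1.
have k2 := half_ge2 oneB convP glP strict half.
have k5 : (5 <= k)%N by move: ok k3 k2; case: (k) => [|[|[|[|[|m]]]]].
have := large_area cr oneB convP glP strict offset half half_min k5.
by move=> /leq_trans /(_ n7).
Qed.

Theorem proposition14 (R : realType) :
  ~ has_convex_presentation (M0 R) /\
  (forall (n : nat) (h v : {perm 'I_n}),
     (n <= 7)%N ->
     in_H11 (square_tiled R h v) ->
     ~ has_strictly_convex_presentation (square_tiled R h v)).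
Proof.
split; first exact: M0_no_convex_presentation.
by move=> n h v; exact: small_H11_no_strictly_convex_presentation.
Qed.
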